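(* Let $S$ be a semidomain. The following are equivalent: (a) $S$ is a UFD; (b) $S[x]$ is a UFS; (c) $S[x^{\pm1}]$ is a UFS; (d) $S$ is an LFD; (e) $S[x]$ is an LFS; (f) $S[x^{\pm1}]$ is an LFS.
   Context: A semidomain is a subset $S$ of an integral domain $R$ containing $0$ and $1$ and closed under addition and multiplication; $S[x]$ (resp. $S[x^{\pm1}]$) is the semidomain of polynomials (resp. Laurent polynomials) in $R[x]$ (resp. $R[x^{\pm1}]$) with coefficients in $S$. For a semidomain $T$, $T^*=T\setminus\{0\}$ is a multiplicative monoid; an atom is a nonunit $a\in T^*$ such that $a=bc$ with $b,c\in T^*$ forces $b$ or $c$ to be a unit; $T$ is atomic if every nonunit of $T^*$ is a finite product of atoms. A factorization of $b$ is a formal product of atoms considered up to order and associates whose product is $b$ up to a unit; its length is the number of atoms with multiplicity. $T$ is a UFS (unique factorization semidomain) if it is atomic and every element of $T^*$ has exactly one factorization; $T$ is an LFS (length-factorial semidomain) if it is atomic and two distinct factorizations of the same element always have distinct lengths. A UFD (resp. LFD) is a semidomain that is an integral domain and a UFS (resp. LFS). *)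

(* Defs.v *)
From HB Require Import structures.
From mathcomp Require Import all_boot all_order all_algebra all_fingroup.
Set Implicit Arguments. Unset Strict Implicit. Unset Printing Implicit Defensive.
Import GRing.Theory.
Local Open Scope ring_scope.

(* A semidomain is represented as a predicate T on an ambient integral
   domain D, containing 0 and 1 and closed under + and *. *)
Section SemidomainNotions.
Variable D : idomainType.
Variable T : D -> Prop.

Definition is_semidomain : Prop :=
  [/\ T 0, T 1, (forall a b, T a -> T b -> T (a + b)) &
      (forall a b, T a -> T b -> T (a * b))].

Definition sd_unit (u : D) : Prop := T u /\ exists v, T v /\ u * v = 1.

Definition sd_atom (a : D) : Prop :=
  [/\ T a, a != 0, ~ sd_unit a &
      forall b c, T b -> b != 0 -> T c -> c != 0 -> a = b * c ->
        sd_unit b \/ sd_unit c].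

Definition sd_assoc (a b : D) : Prop := exists u, sd_unit u /\ a = u * b.

Definition sd_atomic : Prop :=
  forall b, T b -> b != 0 -> ~ sd_unit b ->
    exists s : seq D, (forall a, a \in s -> sd_atom a) /\ b = \prod_(a <- s) a.

Definition sd_fact_of (b : D) (s : seq D) : Prop :=
  (forall a, a \in s -> sd_atom a) /\ sd_assoc b (\prod_(a <- s) a).

Definition sd_fact_eq (s t : seq D) : Prop :=
  size s = size t /\ exists sigma : {perm 'I_(size s)},
    forall i : 'I_(size s),
      sd_assoc (nth 0 s i) (nth 0 t (sigma i)).

Definition UFS : Prop :=
  sd_atomic /\
  forall b, T b -> b != 0 -> forall s t, sd_fact_of b s -> sd_fact_of b t ->
    sd_fact_eq s t.

Definition LFS : Prop :=
  sd_atomic /\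
  forall b, T b -> b != 0 -> forall s t, sd_fact_of b s -> sd_fact_of b t ->
    ~ sd_fact_eq s t -> size s <> size t.

Definition sd_is_domain : Prop := forall a, T a -> T (- a).

Definition UFD : Prop := sd_is_domain /\ UFS.
Definition LFD : Prop := sd_is_domain /\ LFS.

End SemidomainNotions.

Definition polyS (R : idomainType) (S : R -> Prop) : {poly R} -> Prop :=
  fun p => forall i : nat, S p`_i.

(* S[x^{+-1}] : Laurent polynomials with coefficients in S, realised inside
   the fraction field of R[x] (which contains R[x^{+-1}]) as p / x^n with
   p in S[x]. *)
Definition laurentS (R : idomainType) (S : R -> Prop)
  : {fraction {poly R}} -> Prop :=
  fun f => exists (p : {poly R}) (n : nat),
    polyS S p /\ f = FracField.tofrac p / FracField.tofrac ('X^n).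

(* Main.v *)
Require Import Defs.
From HB Require Import structures.
From mathcomp Require Import all_boot all_order all_algebra all_fingroup.
From mathcomp Require Import boolp.
From mathcomp Require Import zify ring.

(* If S[x] or its Laurent version is length-factorial, then so is S, because
   divisors of a constant are constants up to units; moreover -1 lies in S,
   since otherwise x + 1, x^4 + x^2 + 1, x^2 + x + 1 and x^3 + 1 are atoms and
   (x + 1)(x^4 + x^2 + 1) = (x^2 + x + 1)(x^3 + 1) is a pair of distinct
   factorizations of length 2.  In a length-factorial monoid any two
   unbalanced relations between factorizations are proportional, so there is
   at most one irredundant relation a1 ... an = b1 ... bm up to powers; in an
   integral domain the identity
   b1 (b2 ... bm - a1) = a1 (a2 ... an - b1) produces another one, hence a
   length-factorial domain is a UFD.  Gauss's lemma and localization at the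
   powers of x carry unique factorization back to S[x] and its Laurent
   version. *)

Set Implicit Arguments. Unset Strict Implicit. Unset Printing Implicit Defensive.
Import GRing.Theory.
Local Open Scope ring_scope.

(** Both [x^4 + x^2 + 1] and [x^3 + 1] contain the factor [x^2 - x + 1], with cofactors
    [x^2 + x + 1] and [x + 1]. The two products attach this factor to one cofactor or to the other,
    and it is out of reach when [-1] is not in [S]. Recovering [-1] has to come first, because the
    passage from length factoriality to unique factorization subtracts. Proportionality of relations
    is used only in a one-sided form: an unbalanced relation of least length difference, freed of
    common atoms, is contained with multiplicities in every unbalanced relation, up to orientation.
    That already rules out the relation produced by subtraction. What travels between the three
    semidomains is the existence of prime factorizations ([sd_factorial]), which implies [UFS]. [S]
    is only a predicate on [R], and [R] need not be factorial, so divisibility is always relative to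
    [S], and Gauss's lemma goes through pseudo-division rather than a field of fractions. *)

Definition sd_dvd (D : idomainType) (T : D -> Prop) (a b : D) : Prop :=
  exists2 c, T c & b = a * c.

Definition sd_prime (D : idomainType) (T : D -> Prop) (p : D) : Prop :=
  [/\ T p, p != 0, ~ sd_unit T p &
      forall a b, T a -> T b -> sd_dvd T p (a * b) ->
        sd_dvd T p a \/ sd_dvd T p b].

Definition sd_prime_prod (D : idomainType) (T : D -> Prop) (b : D) : Prop :=
  exists u s, [/\ sd_unit T u, (forall p, p \in s -> sd_prime T p) &
                 b = u * \prod_(p <- s) p].

Definition sd_factorial (D : idomainType) (T : D -> Prop) : Prop :=
  forall b, T b -> b != 0 -> sd_prime_prod T b.

(** * Associates, primes and prime factorizations in a semidomain *)

Section Associates.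
Variables (D : idomainType) (T : D -> Prop).
Hypothesis sdT : is_semidomain T.

Let T1 : T 1. Proof. by case: sdT. Qed.
Let TM a b : T a -> T b -> T (a * b). Proof. by case: sdT => _ _ _; apply. Qed.

Lemma sd_unit1 : sd_unit T 1.
Proof. by split=> //; exists 1; rewrite mulr1. Qed.

Lemma sd_unitM u v : sd_unit T u -> sd_unit T v -> sd_unit T (u * v).
Proof.
move=> [Tu [u' [Tu' uu']]] [Tv [v' [Tv' vv']]]; split; first exact: TM.
by exists (u' * v'); split; [exact: TM | rewrite mulrACA uu' vv' mulr1].
Qed.

Lemma sd_unitMl u v : T u -> T v -> sd_unit T (u * v) -> sd_unit T u.
Proof.
move=> Tu Tv [_ [w [Tw uvw]]]; split=> //.
by exists (v * w); rewrite mulrA; split=> //; exact: TM.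
Qed.

Lemma sd_unitMr u v : T u -> T v -> sd_unit T (u * v) -> sd_unit T v.
Proof. by rewrite mulrC => Tu Tv; exact: sd_unitMl. Qed.

Lemma sd_unit_neq0 u : sd_unit T u -> u != 0.
Proof.
move=> [_ [v [_ uv]]]; apply: contra_eq_neq uv => ->.
by rewrite mul0r eq_sym oner_neq0.
Qed.

Lemma sd_assoc_refl a : sd_assoc T a a.
Proof. by exists 1; rewrite mul1r; split=> //; exact: sd_unit1. Qed.

Lemma sd_assoc_sym a b : sd_assoc T a b -> sd_assoc T b a.
Proof.
move=> [u [[Tu [v [Tv uv]]] ->]]; exists v; split;
  last by rewrite mulrA (mulrC v) uv mul1r.
by split=> //; exists u; rewrite mulrC.
Qed.

Lemma sd_assoc_trans a b c : sd_assoc T a b -> sd_assoc T b c -> sd_assoc T a c.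
Proof.
move=> [u [Uu ->]] [v [Uv ->]]; exists (u * v); rewrite mulrA; split=> //.
exact: sd_unitM.
Qed.

Lemma sd_assocM a a' b b' :
  sd_assoc T a a' -> sd_assoc T b b' -> sd_assoc T (a * b) (a' * b').
Proof.
move=> [u [Uu ->]] [v [Uv ->]]; exists (u * v); rewrite mulrACA; split=> //.
exact: sd_unitM.
Qed.

Lemma sd_assocX a b n : sd_assoc T a b -> sd_assoc T (a ^+ n) (b ^+ n).
Proof.
move=> ab; elim: n => [|n IH]; first by rewrite !expr0; exact: sd_assoc_refl.
by rewrite !exprS; exact: sd_assocM.
Qed.

Lemma sd_assocMl_cancel c a b : c != 0 ->
  sd_assoc T (c * a) (c * b) -> sd_assoc T a b.
Proof.
move=> c0 [u [Uu e]]; exists u; split=> //.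
by apply: (mulfI c0); rewrite e mulrCA.
Qed.

Lemma sd_assoc_dvd a b : sd_assoc T a b -> sd_dvd T b a.
Proof. by move=> [u [[Tu _] ->]]; exists u; rewrite // mulrC. Qed.

Lemma sd_dvd_trans a b c : sd_dvd T a b -> sd_dvd T b c -> sd_dvd T a c.
Proof.
by move=> [d Td ->] [e Te ->]; exists (d * e); rewrite ?mulrA //; exact: TM.
Qed.

Lemma sd_dvd_mulr a b c : T c -> sd_dvd T a b -> sd_dvd T a (b * c).
Proof. by move=> Tc [d Td ->]; exists (d * c); rewrite ?mulrA //; exact: TM. Qed.

Lemma sd_dvd_mull a b c : T c -> sd_dvd T a b -> sd_dvd T a (c * b).
Proof. by rewrite mulrC; exact: sd_dvd_mulr. Qed.

Lemma sd_assoc_unit a b : T b -> sd_assoc T a b -> sd_unit T a -> sd_unit T b.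
Proof. by move=> Tb [u [[Tu _] ->]]; exact: sd_unitMr. Qed.

Lemma sd_assoc_atom a b : T b -> sd_assoc T a b -> sd_atom T a -> sd_atom T b.
Proof.
move=> Tb ab [Ta a0 nUa Aa]; split=> //.
- by case: ab a0 => u [_ ->]; apply: contra_neq => ->; rewrite mulr0.
- by move=> Ub; apply: nUa; apply: sd_assoc_unit Ub => //; exact: sd_assoc_sym.
move=> c d Tc c0 Td d0 bcd; case: ab => u [Uu e].
have Tu : T u by case: Uu.
case: (Aa (u * c) d) => //.
- exact: TM.
- by rewrite mulf_neq0 // sd_unit_neq0.
- by rewrite -mulrA -bcd.
- by move/(sd_unitMr Tu Tc); left.
- by right.
Qed.

Lemma sd_prod_in (s : seq D) : (forall a, a \in s -> T a) -> T (\prod_(a <- s) a).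
Proof.
elim: s => [|a s IH] Ts; first by rewrite big_nil.
rewrite big_cons; apply: TM; first exact/Ts/mem_head.
by apply: IH => b bs; apply: Ts; rewrite inE bs orbT.
Qed.

Lemma sd_atoms_in s : (forall a, a \in s -> sd_atom T a) -> T (\prod_(a <- s) a).
Proof. by move=> As; apply: sd_prod_in => a /As []. Qed.

Lemma sd_atoms_neq0 s :
  (forall a, a \in s -> sd_atom T a) -> \prod_(a <- s) a != 0.
Proof.
by move=> As; rewrite prodf_seq_neq0; apply/allP => a /As [].
Qed.

Lemma sd_atom_dvd_atom a b :
  sd_atom T b -> T a -> a != 0 -> ~ sd_unit T a -> sd_dvd T a b -> sd_assoc T b a.
Proof.
move=> [Tb b0 nUb Ab] Ta a0 nUa [c Tc e].
have c0 : c != 0 by apply: contra_neq b0 => c0; rewrite e c0 mulr0.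
case: (Ab a c) => // Uc; exists c; split=> //; first by rewrite e mulrC.
Qed.

Lemma sd_prime_atom p : sd_prime T p -> sd_atom T p.
Proof.
move=> [Tp p0 nUp Pp]; split=> // b c Tb b0 Tc c0 pbc.
have [] : sd_dvd T p b \/ sd_dvd T p c.
  by apply: Pp => //; rewrite -pbc; exists 1; rewrite ?mulr1.
- move=> [d Td e]; right; split=> //; exists d; split=> //.
  by apply: (mulfI p0); rewrite mulr1 {2}pbc e; ring.
- move=> [d Td e]; left; split=> //; exists d; split=> //.
  by apply: (mulfI p0); rewrite mulr1 {2}pbc e; ring.
Qed.

Lemma sd_assoc_prime p q : T q -> sd_assoc T p q -> sd_prime T p -> sd_prime T q.
Proof.
move=> Tq pq Pp; have [_ q0 nUq _] := sd_assoc_atom Tq pq (sd_prime_atom Pp).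
case: Pp => Tp p0 nUp Pp; split=> // a b Ta Tb qab.
have dpq := sd_assoc_dvd pq; have dqp := sd_assoc_dvd (sd_assoc_sym pq).
by case: (Pp a b Ta Tb (sd_dvd_trans dqp qab)) => pd; [left|right];
  apply: sd_dvd_trans pd.
Qed.

Lemma sd_prime_dvd_prod p s : sd_prime T p -> (forall a, a \in s -> T a) ->
  sd_dvd T p (\prod_(a <- s) a) -> exists2 a, a \in s & sd_dvd T p a.
Proof.
move=> [Tp p0 nUp Pp]; elim: s => [|a s IH] Ts.
  rewrite big_nil => -[c Tc e]; case: nUp; split=> //; exists c; split=> //.
have Ts' b : b \in s -> T b by move=> bs; apply: Ts; rewrite inE bs orbT.
rewrite big_cons => /Pp [].
- exact/Ts/mem_head.
- exact: sd_prod_in.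
- by exists a; rewrite ?mem_head.
- by move=> /(IH Ts') [b bs pb]; exists b; rewrite // inE bs orbT.
Qed.

(** A choice function applied to the associate class, seen as a predicate, returns one fixed member
    for the whole class. Lists up to order and associates thus become lists up to permutation. *)
Definition sd_rep (a : D) : D := choose (fun b => `[< sd_assoc T a b >]) a.

Lemma sd_rep_assoc a : sd_assoc T a (sd_rep a).
Proof.
apply/asboolP; rewrite /sd_rep.
by apply: (@chooseP _ (fun b => `[< sd_assoc T a b >])); apply/asboolP/sd_assoc_refl.
Qed.

Lemma sd_rep_eq a b : sd_assoc T a b -> sd_rep a = sd_rep b.
Proof.
move=> ab; rewrite /sd_rep.
have -> : choose (fun c => `[< sd_assoc T b c >]) b =
          choose (fun c => `[< sd_assoc T a c >]) b.
  apply: eq_choose => c; apply: asbool_equiv_eq; split; apply: sd_assoc_trans => //.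
  exact: sd_assoc_sym.
by apply: choose_id; apply/asboolP => //; exact: sd_assoc_refl.
Qed.

Lemma sd_repP a b : sd_rep a = sd_rep b <-> sd_assoc T a b.
Proof.
split; last exact: sd_rep_eq.
move=> e; apply: sd_assoc_trans (sd_rep_assoc a) _; rewrite e.
exact/sd_assoc_sym/sd_rep_assoc.
Qed.

Lemma sd_rep_id a : sd_rep (sd_rep a) = sd_rep a.
Proof. exact/esym/sd_rep_eq/sd_rep_assoc. Qed.

Lemma sd_rep_in a : T a -> T (sd_rep a).
Proof.
have [u [[Tu _] ->]] := sd_assoc_sym (sd_rep_assoc a).
exact: TM.
Qed.

Lemma sd_rep_atom a : sd_atom T a -> sd_atom T (sd_rep a).
Proof.
move=> Aa; apply: sd_assoc_atom (sd_rep_assoc a) (Aa).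
by apply: sd_rep_in; case: Aa.
Qed.

Lemma sd_rep_prod s : sd_assoc T (\prod_(a <- s) a) (\prod_(a <- map sd_rep s) a).
Proof.
elim: s => [|a s IH] /=; first by rewrite big_nil; exact: sd_assoc_refl.
by rewrite !big_cons; apply: sd_assocM => //; exact: sd_rep_assoc.
Qed.

(** The type of permutations depends on [size s]; trading it for an equal [n] lets a bijection on
    the indices of a mapped list serve for the original list. *)
Lemma sd_fact_eqE n s t : size s = n ->
  sd_fact_eq T s t <-> size t = n /\ exists sigma : {perm 'I_n},
    forall i : 'I_n, sd_assoc T (nth 0 s i) (nth 0 t (sigma i)).
Proof. by move=> <-; split=> -[st ?]; split. Qed.

Lemma sd_fact_eqP s t :
  sd_fact_eq T s t <-> perm_eq (map sd_rep s) (map sd_rep t).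
Proof.
split=> [[st [sigma h]]|].
  have sz : size (map sd_rep t) == size s by rewrite size_map st.
  apply/(@tuple_permP _ _ _ (Tuple sz)); exists sigma.
  apply: (@eq_from_nth _ 0); first by rewrite size_map size_tuple.
  move=> i; rewrite size_map => lt_i; rewrite (nth_map 0) //.
  rewrite -[i]/(nat_of_ord (Ordinal lt_i)) -tnth_nth tnth_mktuple.
  rewrite (tnth_nth 0) /= (nth_map 0) -?st //.
apply/sd_repP; exact: (h (Ordinal lt_i)).
move=> e; have st : size s = size t by have := perm_size e; rewrite !size_map.
split=> //; have sz : size (map sd_rep t) == size s by rewrite size_map st.
have /(@tuple_permP _ _ _ (Tuple sz)) [sigma h] := e.
exists sigma => i; apply/sd_repP.
have := congr1 (fun s => nth 0 s i) h.
rewrite -tnth_nth tnth_mktuple (tnth_nth 0) /=.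
by rewrite !(nth_map 0) -?st.
Qed.

Lemma sd_prime_prodM a b :
  sd_prime_prod T a -> sd_prime_prod T b -> sd_prime_prod T (a * b).
Proof.
move=> [u [s [Uu Ps ->]]] [v [t [Uv Pt ->]]]; exists (u * v), (s ++ t).
split; first exact: sd_unitM.
  by move=> p; rewrite mem_cat => /orP[/Ps|/Pt].
by rewrite big_cat mulrACA.
Qed.

Lemma sd_prime_prod_prime p : sd_prime T p -> sd_prime_prod T p.
Proof.
move=> Pp; exists 1, [:: p]; split; [exact: sd_unit1 | | by rewrite big_seq1 mul1r].
by move=> q; rewrite inE => /eqP ->.
Qed.

Lemma sd_prime_prod_unit u : sd_unit T u -> sd_prime_prod T u.
Proof. by move=> Uu; exists u, [::]; rewrite big_nil mulr1. Qed.

(** A prime in the factorization of an atom leaves a unit as cofactor, and primality passes to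
    associates. *)
Lemma factorial_atom_prime a : sd_factorial T -> sd_atom T a -> sd_prime T a.
Proof.
move=> facT Aa; have [Ta a0 nUa ha] := (Aa); have [u [s [Uu Ps e]]] := facT a Ta a0.
case: s Ps e => [|p s] Ps e; first by case: nUa; rewrite e big_nil mulr1.
have Pp : sd_prime T p by apply/Ps/mem_head.
apply: (sd_assoc_prime Ta _ Pp); apply: sd_assoc_sym.
have [Tp p0 nUp _] := (Pp); apply: sd_atom_dvd_atom => //.
exists (u * \prod_(j <- s) j); last by rewrite e big_cons mulrCA.
apply: TM; first by case: Uu.
by apply: sd_prod_in => b bs; case: (Ps b); rewrite // inE bs orbT.
Qed.

(** An atom of the first list is prime, so it divides some atom of the second and is associated to
    it; the pair is cancelled. *)
Lemma factorial_unique s t : sd_factorial T ->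
  (forall a, a \in s -> sd_atom T a) -> (forall a, a \in t -> sd_atom T a) ->
  sd_assoc T (\prod_(a <- s) a) (\prod_(a <- t) a) ->
  perm_eq (map sd_rep s) (map sd_rep t).
Proof.
move=> facT; elim: s t => [|a s IH] t As At e.
  case: t At e => // b t Ab; rewrite big_nil big_cons => e.
  have [Tb _ nUb _] : sd_atom T b by exact/Ab/mem_head.
  case: nUb; apply: (@sd_unitMl _ (\prod_(j <- t) j)) => //.
    by apply: sd_atoms_in => c ct; apply: Ab; rewrite inE ct orbT.
  apply: sd_assoc_unit e sd_unit1; apply: TM => //.
  by apply: sd_atoms_in => c ct; apply: Ab; rewrite inE ct orbT.
have Aa : sd_atom T a by exact/As/mem_head.
have [Ta a0 nUa _] := (Aa); have Pa := factorial_atom_prime facT Aa.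
have As' b : b \in s -> sd_atom T b by move=> bs; apply: As; rewrite inE bs orbT.
have [b bt dab] : exists2 b, b \in t & sd_dvd T a b.
  apply: sd_prime_dvd_prod => //; first by move=> c /At [].
  apply: sd_dvd_trans (sd_assoc_dvd (sd_assoc_sym e)); rewrite big_cons.
  by exists (\prod_(j <- s) j) => //; exact: sd_atoms_in.
have ab : sd_assoc T a b by apply/sd_assoc_sym/sd_atom_dvd_atom => //; exact: At.
have pt := perm_to_rem bt.
rewrite perm_sym (permPl (perm_map sd_rep pt)) perm_sym /= (sd_rep_eq ab) perm_cons.
apply: IH => //; first by move=> c /mem_rem; exact: At.
rewrite big_cons in e; apply: (sd_assocMl_cancel a0); apply: sd_assoc_trans e _.
rewrite (perm_big _ pt) /= big_cons; apply: sd_assocM (sd_assoc_refl _).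
exact: sd_assoc_sym.
Qed.

Lemma factorial_UFS : sd_factorial T -> UFS T.
Proof.
move=> facT; split=> [b Tb b0 nUb|b Tb b0 s t [As bs] [At bt]].
  have [u [[|p s] [Uu Ps e]]] := facT b Tb b0.
    by case: nUb; rewrite e big_nil mulr1.
  (* [sd_atomic] allows no extra unit, so [u] is absorbed into the first prime, which exists because
     [b] is not a unit. *)
  exists (u * p :: s); split; last by rewrite e !big_cons mulrA.
  move=> a; rewrite inE => /predU1P [->|as_]; last first.
    by apply/sd_prime_atom/Ps; rewrite inE as_ orbT.
  have Pp : sd_prime T p by exact/Ps/mem_head.
  apply: sd_assoc_atom (sd_prime_atom Pp).
    by apply: TM; [case: Uu | case: Pp].
  by apply: sd_assoc_sym; exists u.
apply/sd_fact_eqP => //; apply: factorial_unique => //.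
exact: sd_assoc_trans (sd_assoc_sym bs) bt.
Qed.

Lemma UFS_LFS : UFS T -> LFS T.
Proof. by move=> [atT uT]; split=> // b Tb b0 s t bs bt; case; exact: (uT b). Qed.

End Associates.

(** * Length-factorial domains have prime factorizations *)

Section LengthFactorialDomain.
Variables (D : idomainType) (T : D -> Prop).
Hypothesis sdT : is_semidomain T.

Let T1 : T 1. Proof. by case: sdT. Qed.
Let TM a b : T a -> T b -> T (a * b). Proof. by case: sdT => _ _ _; apply. Qed.
Let TD a b : T a -> T b -> T (a + b). Proof. by case: sdT => _ _ h _; apply: h. Qed.

(* Multisets of atoms up to associates are lists of canonical representatives
   up to permutation. *)
Definition reduced_atoms (s : seq D) : Prop :=
  forall a, a \in s -> sd_atom T a /\ sd_rep T a = a.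

(** In the atomic case, this is the congruence presenting the nonzero elements modulo units as a
    quotient of the free commutative monoid on classes of atoms. *)
Definition fact_rel (s t : seq D) : Prop :=
  [/\ reduced_atoms s, reduced_atoms t &
      sd_assoc T (\prod_(a <- s) a) (\prod_(a <- t) a)].

Lemma reduced_atoms_sub s t :
  {subset t <= s} -> reduced_atoms s -> reduced_atoms t.
Proof. by move=> ts rs a /ts /rs. Qed.

Lemma reduced_atoms_cat s t :
  reduced_atoms s -> reduced_atoms t -> reduced_atoms (s ++ t).
Proof. by move=> rs rt a; rewrite mem_cat => /orP[/rs|/rt]. Qed.

Lemma reduced_atomsW s : reduced_atoms s -> forall a, a \in s -> sd_atom T a.
Proof. by move=> rs a /rs []. Qed.

Lemma reduced_prod_in s : reduced_atoms s -> T (\prod_(a <- s) a).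
Proof. by move=> /reduced_atomsW; exact: sd_atoms_in. Qed.

Lemma reduced_prod_neq0 s : reduced_atoms s -> \prod_(a <- s) a != 0.
Proof. by move=> /reduced_atomsW; exact: sd_atoms_neq0. Qed.

Lemma fact_rel_sym s t : fact_rel s t -> fact_rel t s.
Proof. by move=> [rs rt st]; split=> //; exact: sd_assoc_sym. Qed.

Lemma reduced_atoms_rep s :
  (forall a, a \in s -> sd_atom T a) -> reduced_atoms (map (sd_rep T) s).
Proof.
move=> As _ /mapP [a /As Aa ->]; split; first exact: sd_rep_atom.
exact: sd_rep_id.
Qed.

Lemma reduced_fact_exists b : sd_atomic T -> T b -> b != 0 ->
  exists2 s, reduced_atoms s & sd_assoc T b (\prod_(a <- s) a).
Proof.
move=> atT Tb b0; case: (pselect (sd_unit T b)) => [Ub|nUb].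
  by exists [::] => //; rewrite big_nil; exists b; rewrite mulr1.
have [s [As ->]] := atT b Tb b0 nUb.
by exists (map (sd_rep T) s); [exact: reduced_atoms_rep | exact: sd_rep_prod].
Qed.

Lemma LFS_perm_eq s t :
  LFS T -> fact_rel s t -> size s = size t -> perm_eq s t.
Proof.
move=> [_ lfT] [rs rt st] szst.
have : sd_fact_eq T s t.
  apply: contrapT => nst; apply: (lfT (\prod_(a <- s) a)) nst szst.
  - exact: reduced_prod_in.
  - exact: reduced_prod_neq0.
  - by split; [exact: reduced_atomsW | exact: sd_assoc_refl].
  - by split=> //; exact: reduced_atomsW.
move/sd_fact_eqP => /(_ sdT); rewrite !map_id_in // => a; first by case/rt.
by case/rs.
Qed.

(** Cancelling a common atom keeps the relation and the difference of lengths; the latter is written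
    additively because subtraction on [nat] truncates. *)
Lemma fact_rel_cancel s t : fact_rel s t ->
  exists s' t', [/\ fact_rel s' t', (size s + size t' = size s' + size t)%N &
                   forall a, a \in s' -> a \notin t'].
Proof.
have [n] := ubnP (size s); elim: n s t => // n IH s t lt_sn [rs rt st].
have [/hasP [a as_ at_]|/hasPn dis] := boolP (has [in t] s); last first.
  by exists s, t; split.
have ps := perm_to_rem as_; have pt := perm_to_rem at_.
have zs := perm_size ps; have zt := perm_size pt; rewrite /= in zs zt.
have [||s' [t' [r' sz dis]]] := IH (rem a s) (rem a t).
- by lia.
- split; try by [apply: reduced_atoms_sub rs => b /mem_rem
               | apply: reduced_atoms_sub rt => b /mem_rem].
  have [[_ a0 _ _] _] := rs a as_; apply: (sd_assocMl_cancel a0).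
  by move: st; rewrite (perm_big _ ps) (perm_big _ pt) /= !big_cons.
by exists s', t'; split=> //; lia.
Qed.

Let rep_seq n (s : seq D) := flatten (nseq n s).

Let count_rep_seq n s a : count_mem a (rep_seq n s) = (n * count_mem a s)%N.
Proof.
by elim: n => //= n IH; rewrite /rep_seq /= count_cat -/(rep_seq n s) IH mulSn.
Qed.

Let size_rep_seq n s : size (rep_seq n s) = (n * size s)%N.
Proof.
by elim: n => //= n IH; rewrite /rep_seq /= size_cat -/(rep_seq n s) IH mulSn.
Qed.

Let prod_rep_seq n s : \prod_(a <- rep_seq n s) a = (\prod_(a <- s) a) ^+ n.
Proof.
elim: n => [|n IH]; first by rewrite big_nil.
by rewrite /rep_seq /= big_cat -/(rep_seq n s) /= IH exprS.
Qed.

Let reduced_rep_seq n s : reduced_atoms s -> reduced_atoms (rep_seq n s).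
Proof. by move=> rs; elim: n => // n IH; exact: reduced_atoms_cat. Qed.

(* If [d = |w1| - |w2|] and [e = |s| - |t|], then [d s + e w2] and
   [d t + e w1] are factorizations of the same element with the same length. *)
Lemma LFS_fact_rel_count w1 w2 s t : LFS T ->
  fact_rel w1 w2 -> (size w2 < size w1)%N -> (forall a, a \in w1 -> a \notin w2) ->
  fact_rel s t -> (size w1 - size w2 <= size s - size t)%N ->
  forall a, (count_mem a w1 <= count_mem a s)%N /\
            (count_mem a w2 <= count_mem a t)%N.
Proof.
move=> lfT [r1 r2 r12] lt21 dis [rs rt st] ed a.
set d := (size w1 - size w2)%N in ed; set e := (size s - size t)%N in ed.
have : perm_eq (rep_seq d s ++ rep_seq e w2) (rep_seq d t ++ rep_seq e w1).
  apply: LFS_perm_eq => //; first split.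
  - by apply: reduced_atoms_cat; exact: reduced_rep_seq.
  - by apply: reduced_atoms_cat; exact: reduced_rep_seq.
  - rewrite !big_cat /= !prod_rep_seq; apply: sd_assocM => //; apply: sd_assocX => //.
    exact: sd_assoc_sym.
  rewrite !size_cat !size_rep_seq.
  have -> : size w1 = (d + size w2)%N by lia.
  have -> : size s = (e + size t)%N by lia.
  ring.
move/seq.permP => /(_ (pred1 a)); rewrite !count_cat !count_rep_seq.
have d0 : (0 < d)%N by lia.
(* By disjointness at most one of [w1], [w2] contributes to the multiplicity of [a]. It does so with
   coefficient [e], and [d <= e] allows dividing the inequality by [d]. *)
have [a1|a1] := boolP (a \in w1).
  have := count_memPn (dis a a1) => ->; rewrite muln0 addn0 => h; split=> //.
  by nia.
by rewrite (count_memPn a1) muln0 addn0 => h; split=> //; nia.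
Qed.

Lemma count_prod_dvd (s t : seq D) : (forall a, count_mem a s <= count_mem a t)%N ->
  reduced_atoms t -> sd_dvd T (\prod_(a <- s) a) (\prod_(a <- t) a).
Proof.
elim: s t => [|a s IH] t st rt.
  by rewrite big_nil; exists (\prod_(a <- t) a); rewrite ?mul1r //;
    exact: reduced_prod_in.
have at_ : a \in t 
  by have := st a; rewrite /= eqxx -has_pred1 has_count; apply: leq_trans.
have pt := perm_to_rem at_; rewrite (perm_big _ pt) /= !big_cons.
have [b|b /mem_rem /rt //|c Tc ->] := IH (rem a t).
  by have := st b; have /seq.permP -> := pt; rewrite /=; lia.
by exists c; rewrite // mulrA.
Qed.

(** If an unbalanced relation exists, one of least length difference is stripped of common atoms,
    which keeps the difference. Any unbalanced relation then meets the hypotheses of the counting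
    lemma in one of its two orientations, and balanced ones are trivial by length factoriality. *)
Lemma LFD_minimal_rel : LFS T ->
  (forall s t, fact_rel s t -> perm_eq s t) \/
  exists w1 w2, [/\ fact_rel w1 w2, (size w2 < size w1)%N,
    (forall a, a \in w1 -> a \notin w2) &
    forall s t, fact_rel s t -> [\/ perm_eq s t,
      (forall a, count_mem a w1 <= count_mem a s /\
                 count_mem a w2 <= count_mem a t)%N |
      (forall a, count_mem a w1 <= count_mem a t /\
                 count_mem a w2 <= count_mem a s)%N]].
Proof.
move=> lfT.
pose P n := `[< exists s t,
  [/\ fact_rel s t, (size t < size s)%N & (size s - size t)%N = n] >].
case: (pselect (exists n, P n)) => [exP|nP]; last first.
  left=> s t rst; apply: LFS_perm_eq => //.
  case: (ltngtP (size s) (size t)) => // lt_st; case: nP.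
    exists (size t - size s)%N; apply/asboolP; exists t, s; split=> //.
    exact: fact_rel_sym.
  by exists (size s - size t)%N; apply/asboolP; exists s, t.
right; case: (ex_minnP exP) => d /asboolP [s [t [rst lt_ts dE]]] dmin.
have [w1 [w2 [r12 sz dis]]] := fact_rel_cancel rst.
have lt21 : (size w2 < size w1)%N by lia.
have dmin' s' t' : fact_rel s' t' -> (size t' < size s')%N ->
    (size w1 - size w2 <= size s' - size t')%N.
  move=> rst' lt'; have -> : (size w1 - size w2 = d)%N by lia.
  by apply: dmin; apply/asboolP; exists s', t'.
exists w1, w2; split=> // s' t' rst'.
case: (ltngtP (size s') (size t')) => lt_st.
- apply: Or33 => a; apply: LFS_fact_rel_count => //; first exact: fact_rel_sym.
  by apply: dmin' => //; exact: fact_rel_sym.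
- by apply: Or32 => a; apply: LFS_fact_rel_count => //; exact: dmin'.
- by apply: Or31; exact: LFS_perm_eq.
Qed.

Lemma reduced_mem_dvd s a :
  reduced_atoms s -> a \in s -> sd_dvd T a (\prod_(b <- s) b).
Proof.
move=> rs as_; rewrite (perm_big _ (perm_to_rem as_)) /= big_cons.
exists (\prod_(b <- rem a s) b) => //; apply: reduced_prod_in.
by apply: reduced_atoms_sub rs => b /mem_rem.
Qed.

Lemma reduced_atoms_cons a s : reduced_atoms (a :: s) <->
  [/\ sd_atom T a, sd_rep T a = a & reduced_atoms s].
Proof.
split=> [rs|[Aa ra rs] b].
  have [? ?] := rs a (mem_head _ _); split=> //.
  by apply: reduced_atoms_sub rs => b bs; rewrite inE bs orbT.
by rewrite inE => /predU1P [->|/rs].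
Qed.

(** If [a] divides [x * y = a * c], factorizations of [x], [y] and [c] give a relation between
    [a :: C] and [X ++ Y]; its triviality puts [a] among the atoms of [x] or of [y]. *)
Lemma perm_fact_factorial : sd_atomic T ->
  (forall s t, fact_rel s t -> perm_eq s t) -> sd_factorial T.
Proof.
move=> atT permT b Tb b0; have [s rs [u [Uu e]]] := reduced_fact_exists atT Tb b0.
exists u, s; split=> // a as_; have [Aa ra] := rs a as_.
have [Ta a0 nUa _] := (Aa); split=> // x y Tx Ty [c Tc xy].
have T0 : T 0 by case: sdT.
have [->|x0] := eqVneq x 0; first by left; exists 0; rewrite ?mulr0.
have [->|y0] := eqVneq y 0; first by right; exists 0; rewrite ?mulr0.
have c0 : c != 0 by apply: contra_neq (mulf_neq0 x0 y0) => c0; rewrite xy c0 mulr0.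
have [X rX xX] := reduced_fact_exists atT Tx x0.
have [Y rY yY] := reduced_fact_exists atT Ty y0.
have [C rC cC] := reduced_fact_exists atT Tc c0.
have /permT /perm_mem /(_ a) : fact_rel (a :: C) (X ++ Y).
  split; [exact/reduced_atoms_cons | exact: reduced_atoms_cat |].
  rewrite big_cons big_cat /=; apply: (sd_assoc_trans sdT _ (sd_assocM sdT xX yY)).
  by rewrite xy; apply: sd_assocM (sd_assoc_refl sdT a) _ => //; exact: sd_assoc_sym.
rewrite mem_head mem_cat => /esym /orP [aX|aY]; [left|right].
- exact: (sd_dvd_trans sdT (reduced_mem_dvd rX aX) (sd_assoc_dvd xX)).
- exact: (sd_dvd_trans sdT (reduced_mem_dvd rY aY) (sd_assoc_dvd yY)).
Qed.

(* The relation module has rank one, generated by a disjoint relation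
   [a1 w1' = b1 w2'] up to a unit.  Rewriting it as
   [b1 (w2' - a1) = a1 (w1' - b1)] gives a relation that is not one of its
   multiples. *)
Lemma LFD_factorial : sd_is_domain T -> LFS T -> sd_factorial T.
Proof.
move=> TN lfT; have atT : sd_atomic T by case: lfT.
have [permT|[w1 [w2 [r12 lt21 dis tri]]]] := LFD_minimal_rel lfT.
  exact: perm_fact_factorial.
have [rw1 rw2 w12] := (r12).
case: w1 => [//|a w1] in r12 lt21 dis tri rw1 w12 *.
have /reduced_atoms_cons [Aa ra rw1'] := rw1.
have [Ta a0 nUa _] := (Aa).
(* [w1] already denotes a tail, and after this case so does [w2]. An empty right side would make [a]
   a unit. *)
case: w2 => [|b w2] in r12 lt21 dis tri rw2 w12 *.
  case: nUa; apply: (sd_unitMl sdT (v := \prod_(c <- w1) c)) => //.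
    exact: reduced_prod_in.
  move: w12; rewrite big_nil big_cons => w12.
  by have [u [Uu ->]] := w12; rewrite mulr1.
have /reduced_atoms_cons [Ab rb rw2'] := rw2.
have [Tb b0 nUb _] := (Ab).
have /= a_notin := dis a (mem_head _ _).
have [ab a_w2] : a != b /\ a \notin w2.
  by move: a_notin; rewrite inE negb_or => /andP.
(* If [a] were in [s], triviality of the relation, or containment of [a :: w1] in [w2], would put
   [a] in [w2]; the reverse orientation would fit [b :: w2] inside [w2]. *)
have not_rel s : fact_rel w2 s -> a \notin s.
  move=> rs; apply/negP => as_.
  case: (tri _ _ rs) => h.
  - by move/perm_mem/(_ a): h; rewrite as_ (negPf a_w2).
  - by have [] := h a; rewrite /= eqxx (count_memPn a_w2).
  - by have [_] := h b; rewrite /= eqxx add1n ltnn.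
set P := \prod_(c <- w2) c.
have TP : T P by exact: reduced_prod_in.
have P0 : P != 0 by exact: reduced_prod_neq0.
have ndvd_aP : ~ sd_dvd T a P.
  move=> [q Tq Paq].
  have q0 : q != 0 by apply: contra_neq P0 => q0; rewrite Paq q0 mulr0.
  have [s rs qs] := reduced_fact_exists atT Tq q0.
  have /not_rel : fact_rel w2 (a :: s).
    split=> //; first exact/reduced_atoms_cons.
    by rewrite -/P Paq big_cons; apply: sd_assocM (sd_assoc_refl sdT a) qs.
  by rewrite mem_head.
have [u [[Tu _] bPaQ]] := sd_assoc_sym w12.
rewrite !big_cons -/P in bPaQ.
(* The unit is put into [Q] so that [b * P = a * Q] holds exactly, as subtracting [a * b] from both
   sides requires. *)
set Q := u * \prod_(c <- w1) c.
have TQ : T Q by apply: TM => //; exact: reduced_prod_in.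
have Tz : T (P - a) by apply: TD => //; exact: TN.
have Ty : T (Q - b) by apply: TD => //; exact: TN.
have bzay : b * (P - a) = a * (Q - b) by rewrite !mulrBr bPaQ /Q; ring.
have z0 : P - a != 0.
  by apply/eqP => /subr0_eq Pa; apply: ndvd_aP; exists 1; rewrite ?mulr1.
have y0 : Q - b != 0.
  by apply: contra_neq (mulf_neq0 b0 z0) => y0; rewrite bzay y0 mulr0.
have [Z rZ zZ] := reduced_fact_exists atT Tz z0.
have [Y rY yY] := reduced_fact_exists atT Ty y0.
have rel : fact_rel (b :: Z) (a :: Y).
  split; try exact/reduced_atoms_cons.
  rewrite !big_cons; apply: (@sd_assoc_trans _ _ sdT _ (b * (P - a))).
    by apply: sd_assocM (sd_assoc_refl sdT b) (sd_assoc_sym zZ).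
  by rewrite bzay; apply: sd_assocM (sd_assoc_refl sdT a) yY.
have a_notin_Z : a \notin b :: Z.
  rewrite inE negb_or ab /=; apply/negP => aZ; apply: ndvd_aP.
  have [c Tc e] := sd_dvd_trans sdT (reduced_mem_dvd rZ aZ) (sd_assoc_dvd zZ).
  by exists (c + 1); [exact: TD | rewrite mulrDr -e mulr1 subrK].
(* Since [a] is missing from [b :: Z], only the reversed orientation survives: [w1] is contained in
   [Y], so its product divides both [Q - b] and [Q], hence [b]. As [lt21] makes [w1] nonempty, the
   atom [b] equals a member of [w1], against disjointness. *)
case: (tri _ _ rel) => h.
- by move/perm_mem/(_ a): h; rewrite mem_head (negPf a_notin_Z).
- by have [] := h a; rewrite (count_memPn a_notin_Z) /= eqxx.
have dvd_Qb : sd_dvd T (\prod_(c <- w1) c) b.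
  have dY : sd_dvd T (\prod_(c <- w1) c) (\prod_(c <- Y) c).
    by apply: count_prod_dvd rY => c; have [+ _] := h c; rewrite /= leq_add2l.
  have [c Tc e] := sd_dvd_trans sdT dY (sd_assoc_dvd yY).
  exists (u + - c); first by apply: TD => //; exact: TN.
  by rewrite mulrBr -e /Q; ring.
have [c cw1] : exists c, c \in w1.
  by case: (w1) lt21 => [|c ? _]; [case: (size w2) | exists c; rewrite mem_head].
have [Ac rc] := rw1' c cw1.
have bc : sd_assoc T b c.
  have [Tc c0 nUc _] := Ac; apply: sd_atom_dvd_atom => //.
  exact: (sd_dvd_trans sdT (reduced_mem_dvd rw1' cw1) dvd_Qb).
have := dis c; rewrite -[in c \notin _]rc -(sd_rep_eq sdT bc) rb mem_head.
by rewrite inE cw1 orbT => /(_ isT).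
Qed.

End LengthFactorialDomain.

(** * Descent of length factoriality along a divisor-closed embedding *)

Section Transfer.
Variables (D E : idomainType) (A : D -> Prop) (B : E -> Prop).
Variable iota : {rmorphism D -> E}.
Hypotheses (sdA : is_semidomain A) (sdB : is_semidomain B).
Hypothesis iota_inj : injective iota.
Hypothesis iota_in : forall a, A a -> B (iota a).
Hypothesis iota_assoc : forall a b, A a -> A b -> a != 0 ->
  sd_assoc B (iota a) (iota b) -> sd_assoc A a b.
Hypothesis iota_div : forall a f g, A a -> a != 0 -> B f -> B g ->
  iota a = f * g -> exists b c,
  [/\ A b, A c, sd_assoc B f (iota b), sd_assoc B g (iota c) & a = b * c].

Let iota_neq0 a : a != 0 -> iota a != 0.
Proof. by apply: contra_neq => a0; apply: iota_inj; rewrite a0 rmorph0. Qed.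

Let iota_unit a : sd_unit A a -> sd_unit B (iota a).
Proof.
move=> [Aa [b [Ab ab]]]; split; first exact: iota_in.
by exists (iota b); split; [exact: iota_in | rewrite -rmorphM ab rmorph1].
Qed.

Let iota_unit_inv a : A a -> sd_unit B (iota a) -> sd_unit A a.
Proof.
move=> Aa Ua; have [_ A1 _ _] := sdA.
have a0 : a != 0.
  by apply: contra_neq (sd_unit_neq0 Ua) => ->; rewrite rmorph0.
have [|u [Uu ->]] := @iota_assoc a 1 Aa A1 a0; last by rewrite mulr1.
by exists (iota a); rewrite rmorph1 mulr1.
Qed.

Let iota_assocW a b : sd_assoc A a b -> sd_assoc B (iota a) (iota b).
Proof.
move=> [u [Uu ->]]; exists (iota u); split; [exact: iota_unit|].
by rewrite rmorphM.
Qed.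

Let iota_atom a : sd_atom A a -> sd_atom B (iota a).
Proof.
move=> [Aa a0 nUa ha]; split.
- exact: iota_in.
- exact: iota_neq0.
- by move/(iota_unit_inv Aa).
move=> f g Bf f0 Bg g0 e.
have [b [c [Ab Ac fb gc abc]]] := iota_div Aa a0 Bf Bg e.
have [b0 c0] : b != 0 /\ c != 0 by apply/andP; rewrite -negb_or -mulf_eq0 -abc.
have [Ub|Uc] := ha b c Ab b0 Ac c0 abc; [left|right].
- exact: sd_assoc_unit (sd_assoc_sym fb) (iota_unit Ub).
- exact: sd_assoc_unit (sd_assoc_sym gc) (iota_unit Uc).
Qed.

Let atom_of_iota a : A a -> sd_atom B (iota a) -> sd_atom A a.
Proof.
move=> Aa [_ ia0 nUia hia]; split=> //.
- by apply: contra_neq ia0 => ->; rewrite rmorph0.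
- by move/iota_unit.
move=> b c Ab b0 Ac c0 abc.
case: (hia (iota b) (iota c)); rewrite -?rmorphM ?abc //.
- exact: iota_in.
- exact: iota_neq0.
- exact: iota_in.
- exact: iota_neq0.
- by left; apply: iota_unit_inv.
- by right; apply: iota_unit_inv.
Qed.

(** Divisor closure pulls back one atom at a time: up to units, [f] comes from some [b], and the
    cofactor is again the image of an element of [A]. *)
Let iota_fact s : (forall f, f \in s -> sd_atom B f) -> forall a, A a -> a != 0 ->
  sd_assoc B (iota a) (\prod_(f <- s) f) ->
  exists2 t, (forall b, b \in t -> sd_atom A b) & sd_assoc A a (\prod_(b <- t) b).
Proof.
have [_ A1 _ _] := sdA; have [_ _ _ BM] := sdB.
elim: s => [|f s IH] As a Aa a0.
  rewrite big_nil -(rmorph1 iota) => /iota_assoc h.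
  by exists [::]; rewrite ?big_nil //; exact: h.
have Af : sd_atom B f by exact/As/mem_head.
have [Bf _ _ _] := Af.
have As' g : g \in s -> sd_atom B g by move=> gs; apply: As; rewrite inE gs orbT.
rewrite big_cons => -[u [Uu e]].
have [||b [c [Ab Ac fb gc abc]]] := @iota_div a f (u * \prod_(g <- s) g) Aa a0 Bf.
- by apply: BM; [case: Uu | exact: sd_atoms_in].
- by rewrite e; ring.
have [b0 c0] : b != 0 /\ c != 0 by apply/andP; rewrite -negb_or -mulf_eq0 -abc.
have [|t At ct] := IH As' c Ac c0.
  apply: sd_assoc_trans (sd_assoc_sym gc) _ => //.
  by exists u.
exists (b :: t); last first.
  by rewrite abc big_cons; apply: sd_assocM ct => //; exact: sd_assoc_refl.
move=> d; rewrite inE => /predU1P [->|/At //].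
by apply: atom_of_iota => //; apply: sd_assoc_atom fb Af => //; exact: iota_in.
Qed.

(** By [iota_div] atoms stay atoms under [iota], so factorizations of [a] map to factorizations of
    [iota a] of the same length, and [iota_assoc] reflects their equality. *)
Lemma LFS_transfer : LFS B -> LFS A.
Proof.
move=> [atB lfB]; split=> [a Aa a0 nUa|a Aa a0 s t [As as_] [At at_] nst szst].
  have [|s [As e]] := atB (iota a) (iota_in Aa) (iota_neq0 a0).
    by move/(iota_unit_inv Aa).
  have [|t At [u [Uu aut]]] := iota_fact As Aa a0.
    by rewrite e; exact: sd_assoc_refl.
  case: t At aut => [|b t] At aut; first by case: nUa; rewrite aut big_nil mulr1.
  exists (u * b :: t); split; last by rewrite aut !big_cons mulrA.
  move=> c; rewrite inE => /predU1P [->|ct]; last by apply: At; rewrite inE ct orbT.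
  have Ab : sd_atom A b by exact/At/mem_head.
  apply: sd_assoc_atom (Ab) => //; last by apply: sd_assoc_sym; exists u.
  have [_ _ _] := sdA; apply; [by case: Uu | by case: Ab].
have fact_iota r : (forall b, b \in r -> sd_atom A b) ->
    sd_assoc A a (\prod_(b <- r) b) -> sd_fact_of B (iota a) (map iota r).
  move=> Ar ar; split; first by move=> _ /mapP [b /Ar Ab ->]; exact: iota_atom.
  by rewrite big_map -rmorph_prod; exact: iota_assocW.
apply: (lfB (iota a) (iota_in Aa) (iota_neq0 a0) _ _ (fact_iota s As as_)
  (fact_iota t At at_)); last by rewrite !size_map.
move=> /(sd_fact_eqE B _ (size_map iota s)) [_ [sigma h]]; apply: nst.
split=> //; exists sigma => i.
have := h i; rewrite !(nth_map 0) -?szst // => hi.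
have A_s : sd_atom A (nth 0 s i) by apply/As/mem_nth.
have A_t : sd_atom A (nth 0 t (sigma i)) by apply/At/mem_nth; rewrite -szst.
by apply: iota_assoc => //; [case: A_s | case: A_t | case: A_s].
Qed.

End Transfer.

(** * The polynomial semidomain: units and constant divisors *)

Section Polynomials.
Variables (R : idomainType) (S : R -> Prop).
Hypothesis sdS : is_semidomain S.

Let S0 : S 0. Proof. by case: sdS. Qed.
Let S1 : S 1. Proof. by case: sdS. Qed.
Let SD a b : S a -> S b -> S (a + b). Proof. by case: sdS => _ _ h _; apply: h. Qed.
Let SM a b : S a -> S b -> S (a * b). Proof. by case: sdS => _ _ _; apply. Qed.

Lemma polyS_C c : S c -> polyS S c%:P.
Proof. by move=> Sc i; rewrite coefC; case: ifP. Qed.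

Lemma polyS_Xn n : polyS S 'X^n.
Proof. by move=> i; rewrite coefXn; case: eqP. Qed.

Lemma polyS_semidomain : is_semidomain (polyS S).
Proof.
split.
- by move=> i; rewrite coef0.
- by rewrite -polyC1; exact: polyS_C.
- by move=> p q Sp Sq i; rewrite coefD; exact: SD.
- move=> p q Sp Sq i; rewrite coefM; apply: big_ind => // j _; exact: SM.
Qed.

Lemma polyS_domain : sd_is_domain S -> sd_is_domain (polyS S).
Proof. by move=> SN p Sp i; rewrite coefN; exact: SN. Qed.

Lemma polyS_unitC c : sd_unit S c -> sd_unit (polyS S) c%:P.
Proof.
move=> [Sc [d [Sd cd]]]; split; first exact: polyS_C.
by exists d%:P; split; [exact: polyS_C | rewrite -polyCM cd polyC1].
Qed.

Lemma polyS_unitP u :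
  sd_unit (polyS S) u -> exists2 c, sd_unit S c & u = c%:P.
Proof.
move=> [Su [v [Sv uv]]].
have su : size u == 1.
  have : u \is a GRing.unit by apply/unitrPr; exists v.
  by rewrite poly_unitE => /andP[].
have ueq := size1_polyC (eq_leq (eqP su)).
exists u`_0; last exact: ueq.
split; first exact: Su.
by exists v`_0; split; [exact: Sv | rewrite -coef0M uv coef1].
Qed.

Lemma polyS_unit_size u : sd_unit (polyS S) u -> size u = 1%N.
Proof.
by case/polyS_unitP => c /(sd_unit_neq0) c0 ->; rewrite size_polyC c0.
Qed.

Lemma sd_dvd_polyC p g : p != 0 -> polyS S g ->
  sd_dvd (polyS S) p%:P g <-> forall i, sd_dvd S p g`_i.
Proof.
move=> p0 Sg; split=> [[h Sh ->] i|pg].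
  by exists h`_i; rewrite ?coefCM //; exact: Sh.
have /choice [f hf] : forall i, exists c, S c /\ g`_i = p * c.
  by move=> i; have [c Sc e] := pg i; exists c.
(* The chosen cofactors are cut off at [size g], beyond which the coefficients of [g] vanish. *)
exists (\poly_(i < size g) f i).
  by move=> i; rewrite coef_poly; case: ifP => // _; case: (hf i).
apply/polyP => i; rewrite coefCM coef_poly; case: ltnP => [_|le_gi].
  by case: (hf i).
by rewrite mulr0 nth_default.
Qed.

(** * Gauss's lemma: prime factorizations in [S[x]] *)

Section Gauss.
Hypothesis SN : sd_is_domain S.

Let sdP := polyS_semidomain.
Let PN := polyS_domain SN.
Let PD p q : polyS S p -> polyS S q -> polyS S (p + q).
Proof. by case: sdP => _ _ h _; apply: h. Qed.
Let PM p q : polyS S p -> polyS S q -> polyS S (p * q).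
Proof. by case: sdP => _ _ _; apply. Qed.

Lemma sd_dvdD a b c : sd_dvd S a b -> sd_dvd S a c -> sd_dvd S a (b + c).
Proof. by move=> [d Sd ->] [e Se ->]; exists (d + e); rewrite ?mulrDr //; exact: SD. Qed.

Lemma sd_dvd_addr a b c : sd_dvd S a (b + c) -> sd_dvd S a c -> sd_dvd S a b.
Proof.
move=> [d Sd e] [f Sf ce]; exists (d - f); first by apply: SD => //; exact: SN.
by rewrite mulrBr -e -ce addrK.
Qed.

(** Let [i] and [j] be the least indices of coefficients of [a] and [b] not divisible by [p]. In
    degree [i + j] of the product, every term except the one from [i] and [j] is divisible by [p];
    closure under negation lets these terms be subtracted. *)
Lemma sd_prime_polyC p : sd_prime S p -> sd_prime (polyS S) p%:P.
Proof.
move=> [Sp p0 nUp Pp]; split.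
- exact: polyS_C.
- by rewrite polyC_eq0.
- case/polyS_unitP => c Uc /polyC_inj pc; apply: nUp; by rewrite pc.
move=> a b Sa Sb pab; apply: contrapT => /not_orP [na nb].
have least g : polyS S g -> ~ sd_dvd (polyS S) p%:P g ->
    exists i, ~ sd_dvd S p g`_i /\ forall j, (j < i)%N -> sd_dvd S p g`_j.
  move=> Sg; rewrite sd_dvd_polyC // => /existsNP [i0 ni0].
  have ex : exists i, `[< ~ sd_dvd S p g`_i >] by exists i0; apply/asboolP.
  case: (ex_minnP ex) => i /asboolP ni min_i; exists i; split=> // j lt_ji.
  apply: contrapT => nj; move: lt_ji; rewrite ltnNge min_i //.
  exact/asboolP.
have [i [ni hi]] := least a Sa na; have [j [nj hj]] := least b Sb nb.
move/(sd_dvd_polyC p0 (PM Sa Sb)): pab => /(_ (i + j)%N).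
have lt_i : (i < (i + j).+1)%N by rewrite ltnS leq_addr.
rewrite coefM (bigD1 (Ordinal lt_i)) //= addKn => pab.
have [|//|//] := Pp a`_i b`_j (Sa _) (Sb _).
apply: sd_dvd_addr pab _; apply: big_ind => [|x y|k k_i].
- by exists 0; rewrite ?mulr0.
- exact: sd_dvdD.
- have [lt_ki|le_ik] := ltnP k i; first exact/sd_dvd_mulr/hi.
  apply/sd_dvd_mull/hj => //.
  have : (k : nat) != i by apply: contra k_i => /eqP ki; apply/eqP/val_inj.
  by have := ltn_ord k; lia.
Qed.

Hypothesis facS : sd_factorial S.

Definition sd_primitive g := forall p, sd_prime S p -> ~ sd_dvd (polyS S) p%:P g.

(** Constant primes are split off one at a time. Each divides the leading coefficient, so a
    factorization of the latter loses a prime at every round and the process stops. *)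
Lemma primitive_part g : polyS S g -> g != 0 -> exists c h,
  [/\ S c, c != 0, polyS S h, sd_primitive h & g = c%:P * h].
Proof.
move=> Sg g0.
have lg0 : lead_coef g != 0 by rewrite lead_coef_eq0.
have [u [s [Uu Ps e]]] : sd_prime_prod S (lead_coef g).
  by apply: facS => //; exact: Sg.
have [n] := ubnP (size s).
elim: n => // n IH in g Sg g0 u s Uu Ps e {lg0} *; rewrite ltnS => le_sn.
have [pg|] := pselect (sd_primitive g).
  by exists 1, g; split; rewrite ?oner_neq0 ?polyC1 ?mul1r.
move=> /existsNP [p /not_implyP [Pp /contrapT [h Sh gE]]].
have [Sp p0 nUp _] := Pp.
have h0 : h != 0 by apply: contra_neq g0 => h0; rewrite gE h0 mulr0.
have [q qs pq] : exists2 q, q \in s & sd_dvd S p q.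
  apply: (sd_prime_dvd_prod sdS Pp); first by move=> q /Ps [].
  have [_ [v [Sv uv]]] := Uu; exists (v * lead_coef h).
    by apply: SM => //; exact: Sh.
  rewrite mulrCA -(lead_coefC p) -lead_coefM -gE e mulrA (mulrC v) uv mul1r //.
have [v [Uv qE]] : sd_assoc S q p by apply/sd_atom_dvd_atom => //; exact/sd_prime_atom/Ps.
have sz := perm_size (perm_to_rem qs); rewrite /= in sz.
have [||||c [k [Sc c0 Sk Pk hE]]] := IH h Sh h0 (u * v) (rem q s).
- exact: sd_unitM.
- by move=> r /mem_rem /Ps.
- apply: (mulfI p0); rewrite -{1}(lead_coefC p) -lead_coefM -gE e.
  by rewrite (perm_big _ (perm_to_rem qs)) /= big_cons {1}qE; ring.
- by rewrite sz in le_sn.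
exists (p * c), k; split=> //; [exact: SM | exact: mulf_neq0 |].
by rewrite gE hE polyCM mulrA.
Qed.

(** Each prime factor of [c] divides [d * e], hence [e] because [d] is primitive, and can be
    cancelled. This stands in for passing to polynomials over a field of fractions. *)
Lemma primitive_dvd_cancel d e c f : sd_primitive d ->
  polyS S d -> polyS S e -> polyS S f -> S c -> c != 0 ->
  d * e = c%:P * f -> sd_dvd (polyS S) d f.
Proof.
move=> Pd Sd Se Sf Sc c0.
have {Sc c0} [u [s [[Su [v [Sv uv]]] Ps ->]]] := facS Sc c0.
elim: s e Ps Se => [|p s IH] e Ps Se.
  rewrite big_nil mulr1 => de; exists (v%:P * e).
    by apply: PM => //; exact: polyS_C.
  by rewrite mulrCA de mulrA -polyCM (mulrC v) uv polyC1 mul1r.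
have Pp : sd_prime S p by exact/Ps/mem_head.
have Ps' q : q \in s -> sd_prime S q by move=> qs; apply: Ps; rewrite inE qs orbT.
have Sps : S (\prod_(q <- s) q) by apply: (sd_prod_in sdS) => q /Ps' [].
have [_ _ _ hp] := sd_prime_polyC Pp; have [_ p0 _ _] := Pp.
rewrite big_cons => de.
have [|pd|[e' Se' e'E]] := hp d e Sd Se.
- exists ((u * \prod_(q <- s) q)%:P * f).
    by apply: PM => //; apply/polyS_C/SM.
  by rewrite de !polyCM; ring.
- by case: (Pd p Pp).
- apply: (IH e') => //; apply: (@mulfI _ p%:P); first by rewrite polyC_eq0.
  by rewrite mulrCA -e'E de !polyCM; ring.
Qed.

Lemma atom_primitive f : sd_atom (polyS S) f -> (1 < size f)%N -> sd_primitive f.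
Proof.
move=> [Sf f0 nUf hf] sf p Pp [h Sh fE]; have [Sp p0 nUp _] := Pp.
have h0 : h != 0 by apply: contra_neq f0 => h0; rewrite fE h0 mulr0.
have [|||||Up|/polyS_unit_size sh] := hf p%:P h => //.
- exact: polyS_C.
- by rewrite polyC_eq0.
- by case/polyS_unitP: Up => c Uc /polyC_inj pc; apply: nUp; rewrite pc.
- by move: sf; rewrite fE mul_polyC size_scale // sh.
Qed.

Lemma primitive_constant_unit f :
  polyS S f -> f != 0 -> sd_primitive f -> (size f <= 1)%N -> sd_unit (polyS S) f.
Proof.
move=> Sf f0 Pf /size1_polyC fE.
have c0 : f`_0 != 0 by apply: contra_neq f0 => c0; rewrite fE c0.
rewrite fE; apply: polyS_unitC.
have [u [[|p s] [Uu Ps e]]] := facS (Sf 0) c0; first by rewrite e big_nil mulr1.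
have Pp : sd_prime S p by exact/Ps/mem_head.
case: (Pf p Pp); exists (u * \prod_(q <- s) q)%:P.
  apply/polyS_C/SM; first by case: Uu.
  by apply: (sd_prod_in sdS) => q qs; case: (Ps q); rewrite // inE qs orbT.
by rewrite {1}fE e big_cons !polyCM; ring.
Qed.

(** Scaling [q] by the leading coefficient of [d] avoids division and makes the top terms cancel. *)
Lemma size_pseudo_rem (d q : {poly R}) : d != 0 -> (size d <= size q)%N ->
  (size ((lead_coef d)%:P * q - (lead_coef q *: 'X^(size q - size d)) * d)%R
     < size q)%N.
Proof.
move=> d0 le_dq; have d_gt0 : (0 < size d)%N by rewrite size_poly_gt0.
rewrite -[X in (_ < X)%N](prednK (leq_trans d_gt0 le_dq)) ltnS.
apply/leq_sizeP => j le_j.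
rewrite coefB coefCM -scalerAl coefZ coefXnM ltnNge.
have -> /= : (size q - size d <= j)%N by lia.
have [->|lt_j] : j = (size q).-1 \/ (size q <= j)%N by lia.
  have -> : ((size q).-1 - (size q - size d) = (size d).-1)%N by lia.
  by rewrite mulrC subrr.
have -> : q`_j = 0 by rewrite nth_default.
have -> : d`_(j - (size q - size d)) = 0.
  by apply/nth_default/(leq_trans _ (leq_sub2r _ lt_j)); rewrite subKn.
by rewrite !mulr0 subrr.
Qed.

(* A nonzero element [d] of minimal degree in the ideal [(f, g)] divides
   every element of the ideal up to a constant factor, by pseudo-division. *)
Lemma atom_poly_prime f :
  sd_atom (polyS S) f -> (1 < size f)%N -> sd_prime (polyS S) f.
Proof.
move=> Af sf; have [Sf f0 nUf hf] := Af.
have Pf := atom_primitive Af sf.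
split=> // g h Sg Sh [k Sk ghE].
apply: contrapT => /not_orP [nfg nfh].
pose I (q : {poly R}) := exists a b : {poly R},
  [/\ polyS S a, polyS S b & q = a * f + b * g].
have IS q : I q -> polyS S q.
  by move=> [a [b [Sa Sb ->]]]; apply: PD; exact: PM.
have P0 : polyS S 0 by case: sdP.
have P1 : polyS S 1 by case: sdP.
have If : I f by exists 1, 0; split; rewrite // mul1r mul0r addr0.
have Ig : I g by exists 0, 1; split; rewrite // mul1r mul0r add0r.
have IB q r a b : polyS S a -> polyS S b -> I q -> I r -> I (a * q - b * r).
  move=> Sa Sb [a1 [b1 [Sa1 Sb1 ->]]] [a2 [b2 [Sa2 Sb2 ->]]].
  exists (a * a1 + - (b * a2)), (a * b1 + - (b * b2)); split; last by ring.
    by apply: PD; [exact: PM | exact/PN/PM].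
  by apply: PD; [exact: PM | exact/PN/PM].
have exI : exists n, `[< exists d : {poly R}, [/\ I d, d != 0 & size d = n] >].
  by exists (size f); apply/asboolP; exists f.
case: (ex_minnP exI) => _ /asboolP [d [Id d0 <-]] min_d.
have Sd := IS _ Id.
have ld0 : lead_coef d != 0 by rewrite lead_coef_eq0.
(* Pseudo-remainders stay in [I], where no nonzero element is smaller than [d], so the descent ends
   at [0]. *)
have pdiv (q : {poly R}) : I q -> exists (c : R) (r : {poly R}),
    [/\ S c, c != 0, polyS S r & c%:P * q = d * r].
  have [n] := ubnP (size q); elim: n q => // n IH q lt_qn Iq.
  have Sq := IS _ Iq.
  have [->|q0] := eqVneq q 0.
    by exists 1, 0; split; rewrite ?oner_neq0 ?mulr0.
  have le_dq : (size d <= size q)%N by apply: min_d; apply/asboolP; exists q.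
  pose m := lead_coef q *: 'X^(size q - size d).
  have Sm : polyS S m.
    by rewrite /m -mul_polyC; apply: PM; [exact/polyS_C/Sq | exact: polyS_Xn].
  have Ir := IB q d (lead_coef d)%:P m (polyS_C (Sd _)) Sm Iq Id.
  have lt_r : (size ((lead_coef d)%:P * q - m * d)%R < size q)%N.
    exact: size_pseudo_rem.
  have [|c [r [Sc c0 Sr e]]] := IH _ _ Ir; first exact: leq_trans lt_r _.
  exists (c * lead_coef d), (r + c%:P * m); split.
  - by apply: SM => //; exact: Sd.
  - exact: mulf_neq0.
  - by apply: PD => //; apply: PM => //; exact: polyS_C.
  - by rewrite mulrDr -e polyCM; ring.
(* The primitive part of [d] divides the elements of [I] exactly: the constant introduced by
   pseudo-division is removed by [primitive_dvd_cancel]. *)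
have [c [d' [Sc c0 Sd' Pd' dE]]] := primitive_part Sd d0.
have d'_dvd q : I q -> sd_dvd (polyS S) d' q.
  move=> Iq; have [e [r [Se e0 Sr qr]]] := pdiv q Iq.
  apply: (primitive_dvd_cancel (e := c%:P * r) (c := e)) => //.
  - by apply: PM => //; exact: polyS_C.
  - exact: IS.
  - by rewrite qr dE; ring.
have [e Se fE] := d'_dvd f If.
have [d'0 e0] : d' != 0 /\ e != 0 by apply/andP; rewrite -negb_or -mulf_eq0 -fE.
have [Ud'|Ue] := hf d' e Sd' d'0 Se e0 fE; last first.
  apply: nfg; apply: (sd_dvd_trans sdP) (d'_dvd g Ig).
  by apply: sd_assoc_dvd; apply: sd_assoc_sym; exists e; rewrite mulrC.
have [a [b [Sa Sb dab]]] := Id.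
have [w [Sw w1] d'w] := polyS_unitP Ud'.
(* Here [d'] is a unit, so the nonzero constant [c * w] equals [a * f + b * g]. Multiplying by [h]
   shows that [f] divides [c * w * h], and [f] is primitive. *)
apply: nfh.
apply: (primitive_dvd_cancel (e := a * h + b * k) (c := c * w)) => //.
- by apply: PD; exact: PM.
- exact: SM.
- by apply: mulf_neq0 => //; apply: contra_neq d'0 => w0; rewrite d'w w0.
- by rewrite polyCM -d'w -dE dab mulrDl -[b * g * h]mulrA ghE; ring.
Qed.

(** Induction on the size, after splitting off the content. A primitive [h] that is neither a unit
    nor an atom is a product of two nonunits; these are primitive as divisors of [h], hence
    nonconstant, so both are smaller. *)
Lemma factorial_polyS : sd_factorial (polyS S).
Proof.
move=> g; have [n] := ubnP (size g); elim: n g => // n IH g lt_gn Sg g0.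
have [c [h [Sc c0 Sh Ph gE]]] := primitive_part Sg g0.
have h0 : h != 0 by apply: contra_neq g0 => h0; rewrite gE h0 mulr0.
have sgh : size g = size h by rewrite gE mul_polyC size_scale.
rewrite gE; apply: (sd_prime_prodM sdP).
  have [u [s [Uu Ps ->]]] := facS Sc c0.
  exists u%:P, (map polyC s); split; first exact: polyS_unitC.
    by move=> _ /mapP [p /Ps Pp ->]; exact: sd_prime_polyC.
  by rewrite polyCM rmorph_prod big_map.
have [le1|gt1] := leqP (size h) 1.
  exact/sd_prime_prod_unit/primitive_constant_unit.
have nUh : ~ sd_unit (polyS S) h.
  by move/polyS_unit_size => sh; rewrite sh in gt1.
have [Ah|nAh] := pselect (sd_atom (polyS S) h).
  exact/(sd_prime_prod_prime sdP)/atom_poly_prime.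
have [a [b [Sa Sb hE nUa nUb]]] : exists a b,
    [/\ polyS S a, polyS S b, h = a * b, ~ sd_unit (polyS S) a & ~ sd_unit (polyS S) b].
  apply: contrapT => nab; apply: nAh; split=> // a b Sa a0 Sb b0 hE.
  apply: contrapT => /not_orP [nUa nUb]; apply: nab.
  by exists a, b.
have [a0 b0] : a != 0 /\ b != 0 by apply/andP; rewrite -negb_or -mulf_eq0 -hE.
have Pa : sd_primitive a.
  by move=> p Pp pa; apply: (Ph p Pp); rewrite hE; apply: sd_dvd_mulr.
have Pb : sd_primitive b.
  by move=> p Pp pb; apply: (Ph p Pp); rewrite hE; apply: sd_dvd_mull.
have sa : (1 < size a)%N.
  by rewrite ltnNge; apply/negP => /(primitive_constant_unit Sa a0 Pa).
have sb : (1 < size b)%N.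
  by rewrite ltnNge; apply/negP => /(primitive_constant_unit Sb b0 Pb).
have sh : size h = (size a + size b).-1 by rewrite hE size_mul.
by rewrite hE; apply: (sd_prime_prodM sdP); apply: IH => //; lia.
Qed.

End Gauss.
End Polynomials.

(** * Length factoriality forces [-1] into [S] *)

Section NegativeOne.
Variables (R : idomainType) (S : R -> Prop).
Hypothesis sdS : is_semidomain S.

Let SM a b : S a -> S b -> S (a * b). Proof. by case: sdS => _ _ _; apply. Qed.
Let sdP := polyS_semidomain sdS.
Let PD p q : polyS S p -> polyS S q -> polyS S (p + q).
Proof. by case: sdP => _ _ h _; apply: h. Qed.
Let PM p q : polyS S p -> polyS S q -> polyS S (p * q).
Proof. by case: sdP => _ _ _; apply. Qed.

(** The leading coefficients of two factors of [p] multiply to [1], so scaling each factor by the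
    leading coefficient of the other makes both monic within [S[x]], and a constant factor is a
    unit. *)
Lemma monic_atom p : polyS S p -> p \is monic -> (1 < size p)%N ->
  (forall q r, polyS S q -> polyS S r -> q \is monic -> r \is monic ->
     (1 < size q <= size r)%N -> p <> q * r) ->
  sd_atom (polyS S) p.
Proof.
move=> Sp mp sp hp; split=> //; first exact: monic_neq0.
  by move/polyS_unit_size => sp1; rewrite sp1 in sp.
have normal b c : polyS S b -> polyS S c -> p = b * c -> lead_coef c * lead_coef b = 1.
  by move=> Sb Sc pbc; rewrite mulrC -lead_coefM -pbc; exact/eqP.
have unit_of b c : polyS S b -> polyS S c -> p = b * c -> (size b <= 1)%N ->
    sd_unit (polyS S) b.
  move=> Sb Sc pbc /size1_polyC bE; rewrite bE; apply: polyS_unitC => //.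
  split; first exact: Sb.
  exists (lead_coef c); split; first exact: Sc.
  by rewrite mulrC -[b`_0]lead_coefC -bE (normal b c).
have main b c : polyS S b -> polyS S c -> p = b * c -> (size b <= size c)%N ->
    sd_unit (polyS S) b.
  move=> Sb Sc pbc le_bc; apply: (unit_of b c) => //; rewrite leqNgt.
  apply/negP => lt1b; have lbc := normal b c Sb Sc pbc.
  have lb0 : lead_coef b != 0.
    by apply: contra_eq_neq lbc => ->; rewrite mulr0 eq_sym oner_eq0.
  have lc0 : lead_coef c != 0.
    by apply: contra_eq_neq lbc => ->; rewrite mul0r eq_sym oner_eq0.
  apply: (hp ((lead_coef c)%:P * b) ((lead_coef b)%:P * c)).
  - by apply: PM => //; apply: polyS_C => //; exact: Sc.
  - by apply: PM => //; apply: polyS_C => //; exact: Sb.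
  - by rewrite monicE lead_coefM lead_coefC lbc.
  - by rewrite monicE lead_coefM lead_coefC mulrC lbc.
  - by rewrite !mul_polyC !size_scale // lt1b.
  - by rewrite mulrACA -polyCM lbc polyC1 mul1r.
move=> b c Sb b0 Sc c0 pbc; have [le_bc|/ltnW le_cb] := leqP (size b) (size c).
  by left; apply: main pbc le_bc.
by right; apply: main le_cb => //; rewrite mulrC.
Qed.

Lemma monic_linearE (q : {poly R}) : q \is monic -> size q = 2%N -> q = 'X + (q`_0)%:P.
Proof.
move=> /monicP; rewrite lead_coefE => mq sq; rewrite sq in mq.
apply/polyP => -[|[|i]]; rewrite coefD coefX coefC /= ?add0r ?addr0 //.
by rewrite nth_default // sq.
Qed.

Lemma monic_quadraticE (q : {poly R}) : q \is monic -> size q = 3%N ->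
  q = 'X^2 + q`_1 *: 'X + (q`_0)%:P.
Proof.
move=> /monicP; rewrite lead_coefE => mq sq; rewrite sq in mq.
apply/polyP => -[|[|[|i]]]; rewrite !coefD coefXn coefZ coefX coefC /=
  ?mulr0 ?mulr1 ?add0r ?addr0 //.
by rewrite nth_default // sq.
Qed.

(** The vanishing subleading coefficient gives [r_n = - q_0], and the constant term gives
    [q_0 r_0 = 1]; hence [r_n r_0 = -1]. *)
Lemma no_linear_factor (p q r : {poly R}) n : ~ S (-1) ->
  polyS S q -> polyS S r -> q \is monic -> r \is monic ->
  size q = 2%N -> size r = n.+2 -> p`_0 = 1 -> p`_n.+1 = 0 -> p <> q * r.
Proof.
move=> nS Sq Sr mq mr sq sr p0 pn pqr; apply: nS.
have rn : r`_n.+1 = 1 by move/monicP: mr; rewrite lead_coefE sr.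
move: p0 pn; rewrite pqr (monic_linearE mq sq) !mulrDl !coefD !coefCM !coefXM /=.
rewrite add0r rn mulr1.
move=> qr0 rq; have <- : r`_n * r`_0 = -1; last exact: SM.
by rewrite -qr0 -[RHS]mulNr; congr (_ * _); apply/eqP; rewrite -addr_eq0 rq.
Qed.

(** Such an [a] is a root of [t^2 - t + 1], which divides [t^3 + 1]. *)
Lemma sum_prod1_neg1 a d : S a -> a + d = 1 -> a * d = 1 -> S (-1).
Proof.
move=> Sa ad1 ad; have -> : -1 = a * a * a; last by do 2?apply: SM.
have dE : d = 1 - a by rewrite -ad1; ring.
have a2 : a * a = a - 1 by rewrite -ad dE; ring.
by rewrite a2 mulrBl a2; ring.
Qed.

Lemma monicXnD n (r : {poly R}) : (size r <= n)%N ->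
  size ('X^n + r) = n.+1 /\ 'X^n + r \is monic.
Proof.
move=> le_rn; have lt : (size r < size ('X^n : {poly R}))%N by rewrite size_polyXn.
split; first by rewrite size_polyDl // size_polyXn.
by rewrite monicE lead_coefDl // lead_coefXn.
Qed.

Section Atoms.
Hypothesis nS : ~ S (-1).

Lemma atom_X1 : sd_atom (polyS S) ('X^1 + 1).
Proof.
have [s m] : size ('X^1 + 1 : {poly R}) = 2%N /\ ('X^1 + 1 : {poly R}) \is monic.
  by apply: monicXnD; rewrite size_poly1.
apply: monic_atom; rewrite ?s //; first by apply: PD; [exact: polyS_Xn | case: sdP].
move=> q r Sq Sr mq mr szs /(congr1 (fun p => size (p : {poly R}))).
by rewrite s size_monicM ?monic_neq0 //; lia.
Qed.

(** The only splitting to exclude is into two monic linear factors, whose constant terms would have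
    sum and product [1]. *)
Lemma atom_X2X1 : sd_atom (polyS S) ('X^2 + ('X^1 + 1)).
Proof.
have [s1 _] : size ('X^1 + 1 : {poly R}) = 2%N /\ ('X^1 + 1 : {poly R}) \is monic.
  by apply: monicXnD; rewrite size_poly1.
have [s m] : size ('X^2 + ('X^1 + 1) : {poly R}) = 3%N /\
    ('X^2 + ('X^1 + 1) : {poly R}) \is monic.
  by apply: monicXnD; rewrite s1.
apply: monic_atom; rewrite ?s //.
  apply: PD; first exact: polyS_Xn.
  by apply: PD; [exact: polyS_Xn | case: sdP].
move=> q r Sq Sr mq mr szs e.
have := congr1 (fun p => size (p : {poly R})) e.
rewrite s size_monicM ?monic_neq0 // => sqr.
have sq : size q = 2%N by lia.
have sr : size r = 2%N by lia.
rewrite (monic_linearE mq sq) (monic_linearE mr sr) in e.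
apply/nS/(@sum_prod1_neg1 q`_0 r`_0) => //.
  have := congr1 (fun p : {poly R} => p`_1) e.
  rewrite !mulrDl !mulrDr !(coefD, coefXM, coefCM, coefMC, coefXn, coefX, coefC,
    coef1) /=.
  rewrite ?(mulr0,mul0r,addr0,add0r,mulr1,mul1r) addrC; exact: esym.
have := congr1 (fun p : {poly R} => p`_0) e.
rewrite !mulrDl !mulrDr !(coefD, coefXM, coefCM, coefMC, coefXn, coefX, coefC,
    coef1) /=.
by rewrite ?(mulr0,mul0r,addr0,add0r,mulr1,mul1r) => /esym.
Qed.

Lemma atom_X31 : sd_atom (polyS S) ('X^3 + 1).
Proof.
have [s m] : size ('X^3 + 1 : {poly R}) = 4%N /\ ('X^3 + 1 : {poly R}) \is monic.
  by apply: monicXnD; rewrite size_poly1.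
apply: monic_atom; rewrite ?s //; first by apply: PD; [exact: polyS_Xn | case: sdP].
move=> q r Sq Sr mq mr szs e.
have := congr1 (fun p => size (p : {poly R})) e.
rewrite s size_monicM ?monic_neq0 // => sqr.
have sq : size q = 2%N by lia.
have sr : size r = 3%N by lia.
by apply: (no_linear_factor nS Sq Sr mq mr sq sr _ _ e);
  rewrite !(coefD, coefXn, coef1) /= ?(add0r, addr0).
Qed.

Lemma atom_X4X21 : sd_atom (polyS S) ('X^4 + ('X^2 + 1)).
Proof.
have [s1 _] : size ('X^2 + 1 : {poly R}) = 3%N /\ ('X^2 + 1 : {poly R}) \is monic.
  by apply: monicXnD; rewrite size_poly1.
have [s m] : size ('X^4 + ('X^2 + 1) : {poly R}) = 5%N /\
    ('X^4 + ('X^2 + 1) : {poly R}) \is monic.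
  by apply: monicXnD; rewrite s1.
apply: monic_atom; rewrite ?s //.
  apply: PD; first exact: polyS_Xn.
  by apply: PD; [exact: polyS_Xn | case: sdP].
move=> q r Sq Sr mq mr szs e.
have := congr1 (fun p => size (p : {poly R})) e.
rewrite s size_monicM ?monic_neq0 // => sqr.
have [sq|sq] : size q = 2%N \/ size q = 3%N by lia.
  have sr : size r = 4%N by lia.
  by apply: (no_linear_factor nS Sq Sr mq mr sq sr _ _ e);
    rewrite !(coefD, coefXn, coef1) /= ?(add0r, addr0).
have sr : size r = 3%N by lia.
have := (Sq 0%N, Sq 1%N, Sr 0%N, Sr 1%N).
move: (monic_quadraticE mq sq) (monic_quadraticE mr sr).
move: q`_0 q`_1 r`_0 r`_1 => a b d c qE rE [[[Sa Sb] Sd] Sc].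
have eq i := congr1 (fun p : {poly R} => p`_i) e.
have e0 := eq 0%N; have e1 := eq 1%N; have e2 := eq 2%N; have e3 := eq 3%N.
rewrite /= qE rE !mulrDl -!scalerAl !(coefD, coefZ, coefXM, coefXnM, coefCM,
  coefMC, coefXn, coefX, coefC, coef1) /= in e0 e1 e2 e3.
rewrite ?(mulr0,mul0r,addr0,add0r,mulr1,mul1r) in e0 e1 e2 e3.
(* With [q = x^2 + b x + a] and [r = x^2 + c x + d], degrees 3 and 1 give [b = -c] and
   [c (a - d) = 0]. If [c = 0], then [a] and [d] have sum and product [1]. If [a = d], then
   [a^2 = 1], and [a = 1] yields [c^2 = 1], so one of [a], [b], [c] is [-1]. *)
have bE : b = - c by apply/eqP; rewrite -addr_eq0 addrC -e3.
have /eqP : c * (a - d) = 0 by rewrite [RHS]e1 bE; ring.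
rewrite mulf_eq0 => /orP [/eqP c0|/eqP /subr0_eq ad].
  apply/nS/(@sum_prod1_neg1 a d) => //.
  by rewrite [RHS]e2 bE c0; ring.
have : (a - 1) * (a + 1) = 0.
  by apply: (@etrans _ _ (a * d - 1)); [rewrite -ad; ring | rewrite -e0 subrr].
move/eqP; rewrite mulf_eq0 subr_eq0 addr_eq0 => /orP [] /eqP a1; last first.
  by apply: nS; rewrite -a1.
have : (c - 1) * (c + 1) = 0.
  apply: (@etrans _ _ (1 - (d + b * c + a))); last by rewrite -e2 subrr.
  by rewrite -ad a1 bE; ring.
move/eqP; rewrite mulf_eq0 subr_eq0 addr_eq0 => /orP [] /eqP c1.
  by apply: nS; rewrite -c1 -bE.
by apply: nS; rewrite -c1.
Qed.

End Atoms.

(** One argument serves both rings: [iota] is the identity for [S[x]] and the embedding into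
    fractions for Laurent polynomials. There [x] becomes a unit, hence the restriction to nonzero
    constant terms; the four atoms have constant term [1]. *)
Lemma LFS_domain (E : idomainType) (B : E -> Prop) (iota : {rmorphism {poly R} -> E}) :
  is_semidomain B ->
  (forall p : {poly R}, p`_0 != 0 -> sd_atom (polyS S) p -> sd_atom B (iota p)) ->
  (forall p q : {poly R}, p`_0 != 0 -> q`_0 != 0 -> polyS S p -> polyS S q ->
     sd_assoc B (iota p) (iota q) -> size p = size q) ->
  LFS B -> sd_is_domain S.
Proof.
move=> sdB atomB sizeB [_ lfB].
suff SN1 : S (-1) by move=> a Sa; rewrite -mulN1r; exact: SM.
apply: contrapT => nS.
have [s1 _] : size ('X^1 + 1 : {poly R}) = 2%N /\ ('X^1 + 1 : {poly R}) \is monic.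
  by apply: monicXnD; rewrite size_poly1.
have [s2 _] : size ('X^2 + ('X^1 + 1) : {poly R}) = 3%N /\
    ('X^2 + ('X^1 + 1) : {poly R}) \is monic.
  by apply: monicXnD; rewrite s1.
have [s3 _] : size ('X^3 + 1 : {poly R}) = 4%N /\ ('X^3 + 1 : {poly R}) \is monic.
  by apply: monicXnD; rewrite size_poly1.
have A1 := atom_X1; have A2 := atom_X2X1 nS.
have A3 := atom_X31 nS; have A4 := atom_X4X21 nS.
set p1 := 'X^1 + 1 in A1 s1; set p2 := 'X^2 + _ in A2 s2; set p3 := 'X^3 + 1 in A3 s3.
set p4 := 'X^4 + _ in A4.
have c1 : p1`_0 != 0 by rewrite /p1 !(coefD, coefXn, coef1) /= add0r oner_neq0.
have c2 : p2`_0 != 0 by rewrite /p2 !(coefD, coefXn, coef1) /= !add0r oner_neq0.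
have c3 : p3`_0 != 0 by rewrite /p3 !(coefD, coefXn, coef1) /= !add0r oner_neq0.
have c4 : p4`_0 != 0 by rewrite /p4 !(coefD, coefXn, coef1) /= !add0r oner_neq0.
have e : p1 * p4 = p2 * p3 by rewrite /p1 /p2 /p3 /p4; ring.
have A s : (forall a, a \in map iota s -> sd_atom B a) ->
    sd_fact_of B (\prod_(a <- map iota s) a) (map iota s).
  by move=> As; split=> //; exact: sd_assoc_refl.
have A14 : forall a, a \in map iota [:: p1; p4] -> sd_atom B a.
  by move=> a; rewrite !inE => /orP [] /eqP ->; exact: atomB.
have A23 : forall a, a \in map iota [:: p2; p3] -> sd_atom B a.
  by move=> a; rewrite !inE => /orP [] /eqP ->; exact: atomB.
have pe : \prod_(a <- map iota [:: p1; p4]) a = \prod_(a <- map iota [:: p2; p3]) a.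
  by rewrite !big_map !big_cons !big_nil !mulr1 -!rmorphM e.
have f14 := A _ A14; have f23 := A _ A23; rewrite -pe in f23.
apply: (lfB _ _ _ _ _ f14 f23) => //.
- exact: sd_atoms_in A14.
- exact: sd_atoms_neq0 A14.
(* Size separates [x + 1] from associates of [x^2 + x + 1] and [x^3 + 1], so the two factorizations
   of length 2 are distinct. *)
move=> /(sd_fact_eqP sdB) /perm_mem /(_ (sd_rep B (iota p1))).
have P1 : polyS S p1 by case: A1.
have P2 : polyS S p2 by case: A2.
have P3 : polyS S p3 by case: A3.
rewrite /= mem_head !inE => /esym /orP [] /eqP /(sd_repP sdB) /sizeB.
  by rewrite s1 s2 => h; have := h c1 c2 P1 P2.
by rewrite s1 s3 => h; have := h c1 c3 P1 P3.
Qed.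

End NegativeOne.

(** * Laurent polynomials: normal forms [p * x^z] with nonzero constant term *)

Section Laurent.
Variables (R : idomainType) (S : R -> Prop).
Hypothesis sdS : is_semidomain S.

Let sdP := polyS_semidomain sdS.
Let P1 : polyS S 1. Proof. by case: sdP. Qed.
Let PD p q : polyS S p -> polyS S q -> polyS S (p + q).
Proof. by case: sdP => _ _ h _; apply: h. Qed.
Let PM p q : polyS S p -> polyS S q -> polyS S (p * q).
Proof. by case: sdP => _ _ _; apply. Qed.

Local Notation frac := (FracField.tofrac (R := {poly R})).
Local Notation X := (frac 'X).

Let X0 : X != 0. Proof. by rewrite tofrac_eq0 polyX_eq0. Qed.

Let XzD z w : X ^ (z + w) = X ^ z * X ^ w.
Proof. exact: (expfzDr _ _ X0). Qed.

Let frac_inj (p q : {poly R}) : frac p = frac q -> p = q.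
Proof. by move/eqP; rewrite tofrac_eq => /eqP. Qed.

Lemma laurentS_frac p (z : int) : polyS S p -> laurentS S (frac p * X ^ z).
Proof.
move=> Sp; case: z => n.
  exists (p * 'X^n), 0%N; split; first by apply: PM => //; exact: polyS_Xn.
  by rewrite expr0 tofrac1 divr1 tofracM tofracXn.
by exists p, n.+1; split=> //; rewrite tofracXn NegzE.
Qed.

Lemma laurentS_frac0 p : polyS S p -> laurentS S (frac p).
Proof. by move=> /(laurentS_frac 0); rewrite expr0z mulr1. Qed.

Lemma laurentS_semidomain : is_semidomain (laurentS S).
Proof.
split.
- by rewrite -(@tofrac0 {poly R}); apply: laurentS_frac0; case: sdP.
- by rewrite -(@tofrac1 {poly R}); exact: laurentS_frac0.
- move=> _ _ [p [n [Sp ->]]] [q [m [Sq ->]]].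
  exists (p * 'X^m + q * 'X^n), (n + m)%N; split.
    by apply: PD; apply: PM => //; exact: polyS_Xn.
  rewrite tofracD !tofracM exprD tofracM /= !tofracXn addf_div ?expf_neq0 //.
- move=> _ _ [p [n [Sp ->]]] [q [m [Sq ->]]].
  exists (p * q), (n + m)%N; split; first exact: PM.
  by rewrite mulf_div -!tofracM exprD.
Qed.

Let sdL := laurentS_semidomain.

Lemma poly_stripX (p : {poly R}) : p != 0 -> exists n q,
  [/\ p = q * 'X^n, q`_0 != 0 & polyS S p -> polyS S q].
Proof.
move=> p0; have ex : exists i, p`_i != 0.
  by exists (size p).-1; rewrite -lead_coefE lead_coef_eq0.
case: (ex_minnP ex) => n pn min_n; exists n, (drop_poly n p); split.
- apply/polyP => i; rewrite coefMXn coef_drop_poly.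
  case: ltnP => [lt_in|le_ni]; last by rewrite subnK.
  by apply: contraTeq lt_in => /min_n; rewrite leqNgt.
- by rewrite coef_drop_poly.
- by move=> Sp i; rewrite coef_drop_poly.
Qed.

Lemma laurentS_normal f : laurentS S f -> f != 0 ->
  exists p z, [/\ polyS S p, p`_0 != 0 & f = frac p * X ^ z].
Proof.
move=> [p [n [Sp ->]]] f0.
have p0 : p != 0 by apply: contra_neq f0 => ->; rewrite tofrac0 mul0r.
have [m [q [pE q0 Sq]]] := poly_stripX p0.
exists q, (m%:Z - n%:Z); split=> //; first exact: Sq.
by rewrite pE tofracM !tofracXn XzD mulrA -exprnN.
Qed.

(** Moving all powers to one side writes one polynomial as the other times a nonnegative power of
    [x]; a nonzero constant term makes that power trivial. *)
Lemma laurent_normal_uniq (p q : {poly R}) (z w : int) :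
  p`_0 != 0 -> q`_0 != 0 -> frac p * X ^ z = frac q * X ^ w -> p = q.
Proof.
have key (p' q' : {poly R}) (n : nat) :
    p'`_0 != 0 -> frac p' = frac q' * X ^+ n -> p' = q'.
  move=> p0; rewrite -tofracXn -tofracM => /frac_inj pE; move: p0.
  rewrite pE coefMXn; case: n pE => [|n] pE /=; last by rewrite eqxx.
  by rewrite expr0 mulr1.
move=> p0 q0 e.
have e1 : frac p = frac q * X ^ (w - z).
  by rewrite XzD mulrA -e -mulrA -XzD subrr expr0z mulr1.
have e2 : frac q = frac p * X ^ (z - w).
  by rewrite XzD mulrA e -mulrA -XzD subrr expr0z mulr1.
case wz: (w - z) => [n|n].
  by apply: (key p q n) => //; rewrite e1 wz.
by apply/esym/(key q p n.+1) => //; rewrite e2 -opprB wz.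
Qed.

Lemma laurentS_unitX z : sd_unit (laurentS S) (X ^ z).
Proof.
have LX w : laurentS S (X ^ w).
  by rewrite -[X ^ w]mul1r -(@tofrac1 {poly R}); exact: laurentS_frac.
split; first exact: LX.
by exists (X ^ (- z)); split; [exact: LX | rewrite -XzD subrr expr0z].
Qed.

Lemma laurentS_unit_frac u : sd_unit (polyS S) u -> sd_unit (laurentS S) (frac u).
Proof.
move=> [Su [v [Sv uv]]]; split; first exact: laurentS_frac0.
exists (frac v); split; first exact: laurentS_frac0.
by rewrite -tofracM uv tofrac1.
Qed.

Lemma laurentS_assoc_frac p z : sd_assoc (laurentS S) (frac p * X ^ z) (frac p).
Proof. by exists (X ^ z); split; [exact: laurentS_unitX | rewrite mulrC]. Qed.

(** Constant terms multiply, so the product of the normal forms of [f] and [g] is again a normal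
    form, and uniqueness identifies it with [p]. *)
Lemma frac_div (p : {poly R}) f g : p`_0 != 0 -> laurentS S f -> laurentS S g ->
  frac p = f * g -> exists q r, [/\ polyS S q, polyS S r,
    sd_assoc (laurentS S) f (frac q), sd_assoc (laurentS S) g (frac r) & p = q * r].
Proof.
move=> p0 Lf Lg pfg.
have fp0 : frac p != 0.
  by rewrite tofrac_eq0; apply: contra_neq p0 => ->; rewrite coef0.
have [f0 g0] : f != 0 /\ g != 0 by apply/andP; rewrite -negb_or -mulf_eq0 -pfg.
have [q [z [Sq q0 fE]]] := laurentS_normal Lf f0.
have [r [w [Sr r0 gE]]] := laurentS_normal Lg g0.
exists q, r; split=> //; try by [rewrite fE; exact: laurentS_assoc_frac
                               | rewrite gE; exact: laurentS_assoc_frac].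
have qr0 : (q * r)`_0 != 0 by rewrite coef0M mulf_neq0.
apply: (@laurent_normal_uniq _ _ 0 (z + w) p0 qr0).
by rewrite expr0z mulr1 pfg fE gE tofracM XzD mulrACA.
Qed.

Lemma frac_unit_inv (p : {poly R}) : p`_0 != 0 ->
  sd_unit (laurentS S) (frac p) -> sd_unit (polyS S) p.
Proof.
move=> p0 [Lp [g [Lg pg]]]; have c0 : (1 : {poly R})`_0 != 0 by rewrite coef1 oner_neq0.
have g0 : g != 0 by apply: contra_eq_neq pg => ->; rewrite mulr0 eq_sym oner_neq0.
have fp0 : frac p != 0.
  by rewrite tofrac_eq0; apply: contra_neq p0 => ->; rewrite coef0.
have [p' [z [Sp' p'0 pE]]] := laurentS_normal Lp fp0.
have [r [w [Sr r0 gE]]] := laurentS_normal Lg g0.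
have pp' : p = p'.
  by apply: (@laurent_normal_uniq _ _ 0 z p0 p'0); rewrite expr0z mulr1.
split; first by rewrite pp'.
have pr0 : (p * r)`_0 != 0 by rewrite coef0M mulf_neq0.
exists r; split; first exact: Sr.
apply: (@laurent_normal_uniq _ _ w 0 pr0 c0).
by rewrite tofracM -mulrA -gE pg tofrac1 expr0z mulr1.
Qed.

Lemma frac_assoc_inv (p q : {poly R}) : p`_0 != 0 -> q`_0 != 0 -> polyS S q ->
  sd_assoc (laurentS S) (frac p) (frac q) -> sd_assoc (polyS S) p q.
Proof.
move=> p0 q0 Sq [u [Uu e]].
have [u' [z [Su' u'0 uE]]] := laurentS_normal (proj1 Uu) (sd_unit_neq0 Uu).
exists u'; split.
  apply: frac_unit_inv => //.
  have -> : frac u' = u * X ^ (- z).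
    by rewrite uE -mulrA -XzD subrr expr0z mulr1.
  by apply: (sd_unitM sdL) => //; exact: laurentS_unitX.
have uq0 : (u' * q)`_0 != 0 by rewrite coef0M mulf_neq0.
apply: (@laurent_normal_uniq _ _ 0 z p0 uq0).
by rewrite expr0z mulr1 e uE tofracM mulrAC.
Qed.

Lemma frac_atom (p : {poly R}) :
  p`_0 != 0 -> sd_atom (polyS S) p -> sd_atom (laurentS S) (frac p).
Proof.
move=> c0 [Sp p0 nUp hp]; split.
- exact: laurentS_frac0.
- by rewrite tofrac_eq0.
- by move/(frac_unit_inv c0).
move=> f g Lf f0 Lg g0 e.
have [q [r [Sq Sr fq gr pqr]]] := frac_div c0 Lf Lg e.
have [q0 r0] : q != 0 /\ r != 0 by apply/andP; rewrite -negb_or -mulf_eq0 -pqr.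
have [Uq|Ur] := hp q r Sq q0 Sr r0 pqr; [left|right].
- exact: (sd_assoc_unit sdL Lf (sd_assoc_sym fq) (laurentS_unit_frac Uq)).
- exact: (sd_assoc_unit sdL Lg (sd_assoc_sym gr) (laurentS_unit_frac Ur)).
Qed.

(** * Descent from polynomials and Laurent polynomials to constants *)

Lemma constant_div a (q r : {poly R}) : a != 0 -> a%:P = q * r ->
  [/\ q = (q`_0)%:P, r = (r`_0)%:P & a = q`_0 * r`_0].
Proof.
move=> a0 aqr.
have [q0 r0] : q != 0 /\ r != 0.
  by apply/andP; rewrite -negb_or -mulf_eq0 -aqr polyC_eq0.
have sqr : (size q + size r).-1 = 1%N by rewrite -size_mul // -aqr size_polyC a0.
have sq0 : (0 < size q)%N by rewrite size_poly_gt0.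
have sr0 : (0 < size r)%N by rewrite size_poly_gt0.
have sq : (size q <= 1)%N by lia.
have sr : (size r <= 1)%N by lia.
by split; [exact: size1_polyC | exact: size1_polyC | rewrite -coef0M -aqr coefC].
Qed.

Lemma polyC_assoc_inv a b :
  sd_assoc (polyS S) a%:P b%:P -> sd_assoc S a b.
Proof.
move=> [u [/polyS_unitP [c Uc ->]]]; rewrite -polyCM => /polyC_inj ->.
by exists c.
Qed.

Lemma LFS_polyS : LFS (polyS S) -> LFS S.
Proof.
apply: (LFS_transfer (iota := polyC)) => //.
- exact: polyC_inj.
- by move=> a; exact: polyS_C.
- by move=> a b _ _ _; exact: polyC_assoc_inv.
move=> a f g Sa a0 Sf Sg /(constant_div a0) [fE gE aE].
exists f`_0, g`_0; split=> //.
  by rewrite {1}fE; exact: sd_assoc_refl.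
by rewrite {1}gE; exact: sd_assoc_refl.
Qed.

Lemma LFS_laurentS : LFS (laurentS S) -> LFS S.
Proof.
pose iota : {rmorphism R -> {fraction {poly R}}} := (frac \o polyC)%FUN.
have c0 (a : R) : a != 0 -> (a%:P)`_0 != 0 by rewrite coefC.
apply: (LFS_transfer (iota := iota)) => //.
- by move=> a b /frac_inj /polyC_inj.
- by move=> a Sa; exact: (laurentS_frac0 (polyS_C sdS Sa)).
- move=> a b Sa Sb a0 ab; apply/polyC_assoc_inv/frac_assoc_inv => //.
  + exact: c0.
  + apply: c0; apply: contra_neq a0 => b0; case: ab => u [_].
    rewrite b0 /iota /= tofrac0 mulr0 => /eqP.
    by rewrite tofrac_eq0 polyC_eq0 => /eqP.
  + exact: polyS_C.
move=> a f g Sa a0 Lf Lg /(frac_div (c0 a a0) Lf Lg) [q [r [Sq Sr fq gr]]].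
case/(constant_div a0) => qE rE aE.
by exists q`_0, r`_0; split; rewrite // /iota /= -?qE -?rE.
Qed.

Lemma LFS_polyS_domain : LFS (polyS S) -> sd_is_domain S.
Proof.
apply: (LFS_domain sdS (iota := idfun)) => //.
move=> p q _ _ _ _ [u [/polyS_unitP [c /sd_unit_neq0 c0 ->] /= ->]].
by rewrite mul_polyC size_scale.
Qed.

Lemma LFS_laurentS_domain : LFS (laurentS S) -> sd_is_domain S.
Proof.
apply: (LFS_domain sdS (iota := frac) sdL frac_atom).
move=> p q p0 q0 _ Sq /(frac_assoc_inv p0 q0 Sq) [u].
move=> [/polyS_unitP [c /sd_unit_neq0 c0 ->] ->].
by rewrite mul_polyC size_scale.
Qed.

(** * Localization of prime factorizations at the powers of [x] *)

Lemma prime_ndvd_Xn q n : sd_prime (polyS S) q -> ~ sd_dvd (polyS S) q 'X ->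
  ~ sd_dvd (polyS S) q 'X^n.
Proof.
move=> [Sq q0 nUq hq] nqX; elim: n => [|n IH].
  by rewrite expr0 => -[v Sv e]; apply: nUq; split=> //; exists v.
rewrite exprS => /hq [].
- by rewrite -['X]expr1; exact: polyS_Xn.
- exact: polyS_Xn.
- exact: nqX.
- exact: IH.
Qed.

(** Clearing denominators turns divisibility by [q] into divisibility in [S[x]] of [a * b] times a
    power of [x], and [q] divides no such power. *)
Lemma frac_prime q : sd_prime (polyS S) q -> ~ sd_dvd (polyS S) q 'X ->
  sd_prime (laurentS S) (frac q).
Proof.
move=> Pq nqX; have nqXn n := @prime_ndvd_Xn q n Pq nqX.
have [Sq q0 nUq hq] := Pq.
have clear_den (a b : {poly R}) n m :
    frac a / frac 'X^n = frac b / frac 'X^m -> a * 'X^m = b * 'X^n.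
  move/eqP; rewrite eqr_div ?tofracXn ?expf_neq0 // -!tofracXn -!tofracM.
  by rewrite tofrac_eq => /eqP.
split.
- exact: laurentS_frac0.
- by rewrite tofrac_eq0.
- move=> [_ [_ [[r [n [Sr ->]]]]]]; rewrite mulrA -tofracM => e.
  apply: (nqXn n); exists r => //.
  have := @clear_den (q * r) 1 n 0%N; rewrite e expr0 mulr1 mul1r tofrac1 divr1.
  by move=> ->.
move=> _ _ [a [n [Sa ->]]] [b [m [Sb ->]]] [_ [c [k [Sc ->]]]].
rewrite mulf_div mulrA -!tofracM -exprD => /clear_den; rewrite -mulrA => e.
have dvd_frac h i : sd_dvd (polyS S) q h ->
    sd_dvd (laurentS S) (frac q) (frac h / frac 'X^i).
  move=> [h' Sh' ->]; exists (frac h' / frac 'X^i); first by exists h', i.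
  by rewrite mulrA tofracM.
have [|||/dvd_frac|] := hq a (b * 'X^k) => //.
- by apply: PM => //; exact: polyS_Xn.
- exists (c * 'X^(n + m)); last by rewrite e mulrA.
  by apply: PM => //; exact: polyS_Xn.
- by left.
case/hq => //; [exact: polyS_Xn | by move/dvd_frac; right | by move/nqXn].
Qed.

Lemma factorial_laurentS : sd_factorial (polyS S) -> sd_factorial (laurentS S).
Proof.
move=> facP f Lf f0; have [p [z [Sp c0 ->]]] := laurentS_normal Lf f0.
apply: (sd_prime_prodM sdL); last exact/sd_prime_prod_unit/laurentS_unitX.
have p0 : p != 0 by apply: contra_neq c0 => ->; rewrite coef0.
have [u [s [Uu Ps ->]]] := facP p Sp p0.
rewrite tofracM; apply: (sd_prime_prodM sdL).
  exact/sd_prime_prod_unit/laurentS_unit_frac.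
elim: s Ps => [|q s IH] Ps.
  rewrite big_nil tofrac1; apply/sd_prime_prod_unit/sd_unit1/sdL.
rewrite big_cons tofracM; apply: (sd_prime_prodM sdL); last first.
  by apply: IH => r rs; apply: Ps; rewrite inE rs orbT.
have Pq : sd_prime (polyS S) q by exact/Ps/mem_head.
(* A prime of [S[x]] dividing [x] becomes a unit along with [x]; every other prime stays prime. *)
have [[r Sr Xqr]|nqX] := pselect (sd_dvd (polyS S) q 'X); last first.
  exact/(sd_prime_prod_prime sdL)/frac_prime.
apply: sd_prime_prod_unit; apply: (@sd_unitMl _ _ sdL _ (frac r)).
- by apply: laurentS_frac0; case: Pq.
- exact: laurentS_frac0.
- by rewrite -tofracM -Xqr -[X]expr1z; exact: laurentS_unitX.
Qed.

End Laurent.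

Theorem theorem5p5 (R : idomainType) (S : R -> Prop) :
  is_semidomain S ->
  [<-> UFD S;
       UFS (polyS S);
       UFS (laurentS S);
       LFD S;
       LFS (polyS S);
       LFS (laurentS S)].
Proof.
move=> sdS.
have sdP := polyS_semidomain sdS; have sdL := laurentS_semidomain sdS.
(* [LFD S] is the hub: it yields prime factorizations in all three semidomains, and each of the
   other five statements implies it, so every arrow of the cycle passes through it. *)
have facS : LFD S -> sd_factorial S by case=> SN; exact: LFD_factorial.
have facP : LFD S -> sd_factorial (polyS S).
  by move=> lfS; apply: factorial_polyS => //; [case: lfS | exact: facS].
have facL : LFD S -> sd_factorial (laurentS S).
  by move=> /facP; exact: factorial_laurentS.
have lfS_P : LFS (polyS S) -> LFD S.
  by move=> lfP; split; [exact: LFS_polyS_domain | exact: LFS_polyS].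
have lfS_L : LFS (laurentS S) -> LFD S.
  by move=> lfL; split; [exact: LFS_laurentS_domain | exact: LFS_laurentS].
tfae.
- by case=> SN /UFS_LFS lfS; apply/(factorial_UFS sdP)/facP.
- by move/UFS_LFS/lfS_P => lfS; apply/(factorial_UFS sdL)/facL.
- by move/UFS_LFS/lfS_L.
- by move=> lfS; apply/UFS_LFS/(factorial_UFS sdP)/facP.
- by move/lfS_P => lfS; apply/UFS_LFS/(factorial_UFS sdL)/facL.
- move/lfS_L => lfS; split; first by case: lfS.
  exact/(factorial_UFS sdS)/facS.
Qed.
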